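(* Let $n\ge 1$, let $\lambda_i,\alpha_i\in\mathbb C^*$, $h_i(t)\in\mathbb C[t]$ be such that the $\lambda_i$ are pairwise distinct and $\deg h_i(t)=1$ for $1\le i\le n$, and let $V$ be an irreducible $\mathscr V$-module for which there exists $R_V\in\mathbb Z_+$ such that all $L_k$ with $k\ge R_V$ are locally finite on $V$. Then $\bigotimes_{i=1}^n\Phi(\lambda_i,\alpha_i,h_i)\otimes V$ is not isomorphic to any of the following irreducible $\mathscr V$-modules: $$V',\qquad \mathcal N\big(M,\gamma(t)\big),\qquad A_{b'},\qquad \bigotimes_{i=1}^m\Omega(\mu_i,b_i)\otimes V',$$ where $1\le m\in\mathbb Z_+$, $b',b_i\in\mathbb C$ with $b_i\ne1$, $\mu_i\in\mathbb C^*$, $\gamma(t)\in\mathbb C[t]\setminus\mathbb C$, $M$ is an irreducible $\mathfrak a_r$-module, and $V'$ is an irreducible $\mathscr V$-module for which there exists $R_{V'}\in\mathbb Z_+$ such that all $L_i$ with $i\geq R_{V'}$ are locally finite on $V'$.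
   Context: $\mathbb Z_+$ is the set of nonnegative integers. $\mathscr V$ is the Virasoro algebra: the complex Lie algebra with basis $\{L_m,C\mid m\in\mathbb Z\}$ and brackets $[L_m,L_n]=(n-m)L_{m+n}+\delta_{m+n,0}\frac{m^3-m}{12}C$, $[L_m,C]=0$. An operator is locally finite on a space if each vector lies in a finite-dimensional subspace invariant under it. Tensor products carry the usual tensor product action. The statement concerns only those modules of the listed forms that are irreducible over $\mathscr V$. $\Phi(\lambda,\alpha,h)$: for $\lambda,\alpha\in\mathbb C^*$, $h=h(t)\in\mathbb C[t]$, $g(t)=\frac{h(t)-h(\alpha)}{t-\alpha}$, this is (the case $b=-1$ of the paper's family) the $\mathscr V$-module $\mathbb C[s,t]$ with $C$ acting as $0$ and $$L_mf(s,t)=\lambda^m\Big(\big(s+mh(t)-m(m-1)\alpha g(t)\big)f(s-m,t)-m(t-m\alpha)\tfrac{\partial}{\partial t}f(s-m,t)\Big).$$ $\Omega(\mu,b)$: for $\mu\in\mathbb C^*$, $b\in\mathbb C$, this is $\mathbb C[t]$ with $L_nt^i=\mu^n(t-n)^i\big(t+n(b-1)\big)$, $Ct^i=0$ for $i\in\mathbb Z_+$, $n\in\mathbb Z$. $A_{b'}$: for $b'\in\mathbb C$ and an irreducible $\mathbb C[t^{\pm1},t\frac{d}{dt}]$-module $A$, this is the space $A$ with $L_nw=\big(t^n(t\frac{d}{dt})+nb't^n\big)w$, $Cw=0$ for $n\in\mathbb Z$, $w\in A$. $\mathcal N(M,\gamma(t))$: let $\mathscr V_+=\mathrm{span}\{L_i\mid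 i\in\mathbb Z_+\}$, and for $r\in\mathbb Z_+$ let $\mathscr V_r=\mathrm{span}\{L_i\mid i>r\}$, an ideal of $\mathscr V_+$; put $\mathfrak a_r=\mathscr V_+/\mathscr V_r$ and $\bar L_i=L_i+\mathscr V_r$. Let $M$ be an irreducible $\mathfrak a_r$-module on which $\bar L_r$ acts injectively. For $\gamma(t)\in\mathbb C[t]\setminus\mathbb C$, $\mathcal N(M,\gamma(t))$ is $M\otimes\mathbb C[t^{\pm1}]$ with $$L_n(v\otimes t^k)=\Big(kv+\sum_{i=0}^r\frac{n^{i+1}}{(i+1)!}\bar L_iv\Big)\otimes t^{n+k}+v\otimes t^{n+k}\gamma(t),\qquad C(v\otimes t^k)=0$$ for $k,n\in\mathbb Z$, $v\in M$. *)

(* Defs.v *)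
From HB Require Import structures.
From mathcomp Require Import all_boot all_order all_algebra.
From mathcomp Require Import boolp reals complex finmap.
From mathcomp.multinomials Require Import monalg.
From mathcomp Require Import ring lra zify.

Set Implicit Arguments.
Unset Strict Implicit.
Unset Printing Implicit Defensive.

Import Order.TTheory GRing.Theory Num.Theory.
Local Open Scope ring_scope.

Section LinearFacts.
Variables (K : fieldType) (U V : lmodType K) (f : U -> V).
Hypothesis lf : linear f.

Lemma linf0 : f 0 = 0.
Proof. by have := lf (-1) 0 0; rewrite scaler0 addr0 scaleN1r addNr. Qed.
Lemma linfD : {morph f : u v / u + v}.
Proof. by move=> u v; have := lf 1 u v; rewrite !scale1r. Qed.
Lemma linfZ a : {morph f : u / a *: u}.
Proof. by move=> u; have := lf a u 0; rewrite linf0 !addr0. Qed.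
Lemma linfB : {morph f : u v / u - v}.
Proof. by move=> u v; rewrite -scaleN1r linfD linfZ scaleN1r. Qed.
Lemma linf_sum (I : Type) (r : seq I) (P : pred I) (F : I -> U) :
  f (\sum_(i <- r | P i) F i) = \sum_(i <- r | P i) f (F i).
Proof. exact: (big_morph f linfD linf0). Qed.
End LinearFacts.

Lemma lin_comp (K : fieldType) (U V W : lmodType K) (f : V -> W) (g : U -> V) :
  linear f -> linear g -> linear (fun u => f (g u)).
Proof. by move=> lf lg a u v; rewrite lg lf. Qed.

Lemma lin_add (K : fieldType) (U V : lmodType K) (f g : U -> V) :
  linear f -> linear g -> linear (fun u => f u + g u).
Proof. by move=> lf lg a u v; rewrite lf lg scalerDr addrACA. Qed.

Lemma lin_scale (K : fieldType) (U V : lmodType K) (f : U -> V) c :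
  linear f -> linear (fun u => c *: f u).
Proof. by move=> lf a u v; rewrite lf scalerDr !scalerA mulrC. Qed.

(* {malg K[I]} is used only as the free K-vector space on I, with basis the
   vectors << i >>; its convolution product plays no role. *)

Section LinearExtension.
Variables (K : fieldType) (I : choiceType) (V : lmodType K).

Definition lext (f : I -> V) (x : {malg K[I]}) : V :=
  \sum_(i <- msupp x) x@_i *: f i.

Lemma lextEw (f : I -> V) (d : {fset I}) x :
  (msupp x `<=` d)%fset -> lext f x = \sum_(i <- d) x@_i *: f i.
Proof.
move=> sxd; rewrite /lext (big_fset_incl _ sxd) // => i _.
by move/mcoeff_outdom=> ->; rewrite scale0r.
Qed.

Lemma lext_linear f : linear (lext f).
Proof.
move=> a x y.
pose d := (msupp x `|` msupp y `|` msupp (a *: x + y)%R)%fset.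
rewrite (@lextEw f d (a *: x + y)) ?fsubsetUr //.
rewrite (@lextEw f d x); last by rewrite /d -fsetUA fsubsetUl.
rewrite (@lextEw f d y); last first.
  by rewrite /d (fsetUC (msupp x)) -fsetUA fsubsetUl.
rewrite scaler_sumr -big_split; apply: eq_bigr => i _ /=.
by rewrite mcoeffD mcoeffZ scalerDl scalerA.
Qed.

HB.instance Definition _ f :=
  GRing.isLinear.Build K {malg K[I]} V *:%R (lext f) (lext_linear f).

Lemma lextU f i : lext f << i >> = f i.
Proof.
rewrite (@lextEw f [fset i]%fset) ?msuppU_le //.
by rewrite big_seq_fset1 mcoeffUU scale1r.
Qed.

Lemma malg_lin_ext (f g : {malg K[I]} -> V) : linear f -> linear g ->
  (forall i, f << i >> = g << i >>) -> forall x, f x = g x.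
Proof.
move=> lf lg fg x.
rewrite [x]monalgE; elim: (enum_fset (msupp x)) => [|i s IHs].
  by rewrite big_nil (linf0 lf) (linf0 lg).
rewrite big_cons.
have -> : << x@_i *g i >> = x@_i *: << i >> :> {malg K[I]}.
  apply/malgP=> k; rewrite mcoeffZ !mcoeffU.
  by case: eqP; rewrite ?mulr1n ?mulr0n ?mulr1 ?mulr0.
by rewrite lf lg fg IHs.
Qed.

End LinearExtension.

Lemma bracket_cancel (V : zmodType) (a b c d p q : V) :
  a - b + (c - d) = a + p + (q + c) - (b + q + (p + d)).
Proof.
by rewrite !opprD !addrA [RHS](ACl (1*5*4*8*(2*7)*(3*6))) /= !subrr !addr0.
Qed.

Section Tensor.
Variables (K : fieldType) (V W : lmodType K).
Local Notation F := {malg K[(V * W)%type]}.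

(* The subspace of F spanned by the relations expressing bilinearity. *)
Inductive bilin_rel : F -> Prop :=
| bilin_rel0 : bilin_rel 0
| bilin_relP a x y : bilin_rel x -> bilin_rel y -> bilin_rel (a *: x + y)
| bilin_rell a v v' w :
    bilin_rel (<< (a *: v + v', w) >> - (a *: << (v, w) >> + << (v', w) >>))
| bilin_relr a v w w' :
    bilin_rel (<< (v, a *: w + w') >> - (a *: << (v, w) >> + << (v, w') >>)).

Definition bilin_null : {pred F} := [pred x | `[< bilin_rel x >]].

Lemma bilin_null_closed : zmod_closed bilin_null.
Proof.
split; first by apply/asboolP; exact: bilin_rel0.
move=> x y /asboolP Rx /asboolP Ry; apply/asboolP.
by rewrite addrC -scaleN1r; exact: bilin_relP.
Qed.

HB.instance Definition _ := GRing.isZmodClosed.Build F bilin_null bilin_null_closed.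

Definition tensor : Type := Quotient.quot bilin_null.
HB.instance Definition _ := GRing.Zmodule.on tensor.

Definition tproj (x : F) : tensor := \pi_(Quotient.quot bilin_null)%qT x.
Definition trepr (x : tensor) : F := @repr _ (Quotient.quot bilin_null) x.

Lemma treprK x : tproj (trepr x) = x.
Proof. exact: reprK. Qed.

Lemma tproj_eqP x y : tproj x = tproj y <-> bilin_rel (x - y).
Proof.
split=> [/eqP|Rxy]; first by rewrite -Quotient.idealrBE => /asboolP.
by apply/eqP; rewrite -Quotient.idealrBE; apply/asboolP.
Qed.

Lemma tprojB x y : tproj (x - y) = tproj x - tproj y.
Proof. exact: (raddfB \pi_(Quotient.quot bilin_null)%qT). Qed.
Lemma tprojD x y : tproj (x + y) = tproj x + tproj y.
Proof. exact: (raddfD \pi_(Quotient.quot bilin_null)%qT). Qed.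

Definition tscale (a : K) (x : tensor) : tensor := tproj (a *: trepr x).

Lemma tscaleE a x : tscale a (tproj x) = tproj (a *: x).
Proof.
apply/tproj_eqP; rewrite -scalerBr -[_ *: _]addr0.
by apply: bilin_relP; [apply/tproj_eqP; rewrite treprK | exact: bilin_rel0].
Qed.

Lemma tscaleA a b x : tscale a (tscale b x) = tscale (a * b) x.
Proof. by rewrite -[x]treprK !tscaleE scalerA. Qed.
Lemma tscale1 : left_id 1 tscale.
Proof. by move=> x; rewrite -[x]treprK tscaleE scale1r. Qed.
Lemma tscaleDr : right_distributive tscale +%R.
Proof.
by move=> a x y; rewrite -[x]treprK -[y]treprK -tprojD !tscaleE -tprojD scalerDr.
Qed.
Lemma tscaleDl x : {morph tscale^~ x : a b / a + b}.
Proof. by move=> a b; rewrite -[x]treprK !tscaleE -tprojD scalerDl. Qed.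

HB.instance Definition _ :=
  GRing.Zmodule_isLmodule.Build K tensor tscaleA tscale1 tscaleDr tscaleDl.

Definition tens (v : V) (w : W) : tensor := tproj << (v, w) >>.

Lemma tproj_linear : linear tproj.
Proof. by move=> a x y; rewrite tprojD -tscaleE. Qed.

Lemma tens_linearl w : linear (tens^~ w).
Proof.
by move=> a v v'; rewrite /tens -tproj_linear; apply/tproj_eqP/bilin_rell.
Qed.
Lemma tens_linearr v : linear (tens v).
Proof.
by move=> a w w'; rewrite /tens -tproj_linear; apply/tproj_eqP/bilin_relr.
Qed.

(* The linear map on V (x) W induced by f; meaningful for bilinear f, see
   tliftE. *)
Definition tlift (U : lmodType K) (f : V -> W -> U) (x : tensor) : U :=
  lext (fun p => f p.1 p.2) (trepr x).

Section Lift.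
Variables (U : lmodType K) (f : V -> W -> U).
Hypothesis f_linl : forall w, linear (f^~ w).
Hypothesis f_linr : forall v, linear (f v).

Lemma bilin_rel_lext x : bilin_rel x -> lext (fun p => f p.1 p.2) x = 0.
Proof.
elim=> [|a y z _ IHy _ IHz|a v v' w|a v w w'].
- exact: raddf0.
- by rewrite linearP /= IHy IHz scaler0 addr0.
- by rewrite linearB /= linearP /= !lextU /= f_linl subrr.
- by rewrite linearB /= linearP /= !lextU /= f_linr subrr.
Qed.

Lemma tlift_proj x : tlift f (tproj x) = lext (fun p => f p.1 p.2) x.
Proof.
apply/eqP; rewrite -subr_eq0 -linearB /=; apply/eqP/bilin_rel_lext.
by apply/tproj_eqP; rewrite treprK.
Qed.

Lemma tlift_linear : linear (tlift f).
Proof.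
move=> a x y; rewrite -[x]treprK -[y]treprK -tproj_linear !tlift_proj.
exact: linearP.
Qed.

Lemma tliftE v w : tlift f (tens v w) = f v w.
Proof. by rewrite tlift_proj lextU. Qed.
End Lift.

Lemma tensor_lin_ext (U : lmodType K) (f g : tensor -> U) : linear f -> linear g ->
  (forall v w, f (tens v w) = g (tens v w)) -> forall x, f x = g x.
Proof.
move=> lf lg fg x; rewrite -[x]treprK.
apply: (@malg_lin_ext K _ U (f \o tproj) (g \o tproj)) => [a y z|a y z|[v w]].
- by rewrite /= tproj_linear lf.
- by rewrite /= tproj_linear lg.
- exact: fg.
Qed.

End Tensor.

(* A Lie algebra with a distinguished basis: the underlying vector space is
   {malg K[lie_basis]}, and the bracket is given on basis vectors. *)
Record lieAlgebra (K : fieldType) := LieAlgebra {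
  lie_basis : choiceType;
  lie_br : lie_basis -> lie_basis -> {malg K[lie_basis]};
  lie_br_alt : forall x, lie_br x x = 0;
  lie_br_anti : forall x y, lie_br x y = - lie_br y x;
  lie_jacobi : forall x y z,
    lext (lie_br x) (lie_br y z) + lext (lie_br y) (lie_br z x)
      + lext (lie_br z) (lie_br x y) = 0 }.

Record lieModule (K : fieldType) (g : lieAlgebra K) := LieModule {
  lie_carrier :> lmodType K;
  act : lie_basis g -> lie_carrier -> lie_carrier;
  act_linear : forall x, linear (act x);
  act_br : forall x y v,
    lext (act^~ v) (lie_br x y) = act x (act y v) - act y (act x v) }.

Arguments act {K g l} x v : rename.

Section LieModuleTheory.
Variables (K : fieldType) (g : lieAlgebra K).

(* With the axioms of boolp, {pred V} ranges over all subsets of V. *)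
Definition is_submodule (V : lieModule g) (S : {pred V}) : Prop :=
  submod_closed S /\ forall x v, v \in S -> act x v \in S.

Definition irreducible (V : lieModule g) : Prop :=
  (exists v : V, v != 0) /\
  forall S : {pred V}, is_submodule S ->
    (forall v, v \in S -> v = 0) \/ (forall v, v \in S).

Definition isomorphic (V W : lieModule g) : Prop :=
  exists f : V -> W,
    [/\ linear f, bijective f & forall x v, f (act x v) = act x (f v)].

Section TensorModule.
Variables V W : lieModule g.

Definition tensor_act (x : lie_basis g) : tensor V W -> tensor V W :=
  tlift (fun v w => tens (act x v) w + tens v (act x w)).

Lemma tensor_act_linl x (w : W) :
  linear (fun v : V => tens (act x v) w + tens v (act x w)).
Proof.
by move=> a u v; rewrite act_linear !tens_linearl scalerDr addrACA.
Qed.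

Lemma tensor_act_linr x (v : V) :
  linear (fun w : W => tens (act x v) w + tens v (act x w)).
Proof.
by move=> a u w; rewrite act_linear !tens_linearr scalerDr addrACA.
Qed.

Lemma tensor_actE x v w :
  tensor_act x (tens v w) = tens (act x v) w + tens v (act x w).
Proof.
exact: (tliftE (fun w => @tensor_act_linl x w) (fun v => @tensor_act_linr x v)).
Qed.

Lemma tensor_act_linear x : linear (tensor_act x).
Proof.
exact: (tlift_linear (fun w => @tensor_act_linl x w)
                     (fun v => @tensor_act_linr x v)).
Qed.

Lemma tensor_act_br x y u :
  lext (tensor_act^~ u) (lie_br x y) =
    tensor_act x (tensor_act y u) - tensor_act y (tensor_act x u).
Proof.
have lD x1 := linfD (tensor_act_linear x1).
move: u; apply: tensor_lin_ext => [a u v|a u v|v w].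
- rewrite /lext scaler_sumr -big_split; apply: eq_bigr => z _ /=.
  by rewrite tensor_act_linear scalerDr !scalerA [a * _]mulrC.
- by rewrite !tensor_act_linear scalerBr opprD addrACA.
- rewrite !tensor_actE !lD !tensor_actE.
  have -> : lext (tensor_act^~ (tens v w)) (lie_br x y) =
      tens (lext (act^~ v) (lie_br x y)) w + tens v (lext (act^~ w) (lie_br x y)).
    move: (lie_br x y); apply: malg_lin_ext => [a b c|a b c|z].
    + exact: linearP.
    + by rewrite !linearP /= tens_linearl tens_linearr scalerDr addrACA.
    + by rewrite !lextU tensor_actE.
  have tBl c : {morph (@tens _ V W)^~ c : a b / a - b}.
    exact: linfB (tens_linearl c).
  have tBr c := linfB (@tens_linearr _ V W c).
  by rewrite !act_br tBl tBr; exact: bracket_cancel.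
Qed.

Definition tensor_module : lieModule g :=
  LieModule tensor_act_linear tensor_act_br.
End TensorModule.

(* V_1 (x) (V_2 (x) ... (V_n (x) W)) for Vs = [:: V_1; ...; V_n]. *)
Definition tensor_list (Vs : seq (lieModule g)) (W : lieModule g) :=
  foldr tensor_module W Vs.

End LieModuleTheory.

Definition in_span (K : fieldType) (V : lmodType K) (s : seq V) (v : V) : Prop :=
  exists c : 'I_(size s) -> K, v = \sum_(i < size s) c i *: s`_i.

Definition locally_finite (K : fieldType) (V : lmodType K) (T : V -> V) : Prop :=
  forall v, exists s : seq V,
    in_span s v /\ forall u, in_span s u -> in_span s (T u).

Inductive vir_basis := VirL of int | VirC.

Definition vir_basis_code (x : vir_basis) : option int :=
  if x is VirL m then Some m else None.
Definition vir_basis_decode (x : option int) : vir_basis :=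
  if x is Some m then VirL m else VirC.
Lemma vir_basis_codeK : cancel vir_basis_code vir_basis_decode.
Proof. by case. Qed.
HB.instance Definition _ := Choice.copy vir_basis (can_type vir_basis_codeK).

Section Virasoro.
Variable K : numFieldType.
Implicit Types m n : int.

Definition vir_br (x y : vir_basis) : {malg K[vir_basis]} :=
  match x, y with
  | VirL m, VirL n =>
      (n - m)%:~R *: << VirL (m + n) >>
        + (if m + n == 0 then (m%:~R ^+ 3 - m%:~R) / 12%:R else 0) *: << VirC >>
  | _, _ => 0
  end.

Lemma vir_br_alt x : vir_br x x = 0.
Proof.
case: x => [m|] //=; rewrite subrr scale0r add0r.
case: eqP => [m0|]; last by rewrite scale0r.
have -> : m = 0 by lia.
by rewrite expr0n subrr mul0r scale0r.
Qed.

Lemma vir_br_anti x y : vir_br x y = - vir_br y x.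
Proof.
case: x y => [m|] [n|]; try by rewrite /= oppr0.
rewrite /vir_br (addrC n m) opprD; congr (_ + _); rewrite -scaleNr;
  congr (_ *: _); first by rewrite -rmorphN /= opprB.
case: eqP => [mn0|]; rewrite ?oppr0 //.
have -> : n = - m by lia.
by rewrite rmorphN /=; ring.
Qed.

Lemma vir_jacobi x y z :
  lext (vir_br x) (vir_br y z) + lext (vir_br y) (vir_br z x)
    + lext (vir_br z) (vir_br x y) = 0.
Proof.
have brCl u : vir_br VirC u = 0 by [].
have brCr u : vir_br u VirC = 0 by case: u.
have ext0 (f : vir_basis -> {malg K[vir_basis]}) : lext f 0 = 0.
  exact: raddf0.
have extC u : lext (vir_br VirC) u = 0.
  by rewrite /lext big1 // => i _; rewrite scaler0.
have extL k l q : lext (vir_br (VirL k)) (vir_br (VirL l) (VirL q)) =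
    (q - l)%:~R *: vir_br (VirL k) (VirL (l + q)).
  by rewrite linearD !linearZ /= !lextU brCr scaler0 addr0.
have zero3 (u v w : {malg K[vir_basis]}) : u = 0 -> v = 0 -> w = 0 -> u + v + w = 0.
  by move=> -> -> ->; rewrite !addr0.
have extr u v : u = VirC \/ v = VirC -> forall w, lext (vir_br w) (vir_br u v) = 0.
  by case=> -> w; rewrite ?brCl ?brCr ext0.
case: x => [m|]; last by apply: zero3; [exact: extC | apply: extr; right | apply: extr; left].
case: y => [n|]; last by apply: zero3; [apply: extr; left | exact: extC | apply: extr; right].
case: z => [p|]; last by apply: zero3; [apply: extr; right | apply: extr; left | exact: extC].
apply: (etrans (congr2 +%R (congr2 +%R (extL m n p) (extL n p m)) (extL p m n))).
rewrite /vir_br.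
have [-> ->] : n + (p + m) = m + (n + p) /\ p + (m + n) = m + (n + p) by lia.
have collect (V : lmodType K) (e f : V) a1 b1 a2 b2 a3 b3 :
    a1 *: e + b1 *: f + (a2 *: e + b2 *: f) + (a3 *: e + b3 *: f) =
    (a1 + a2 + a3) *: e + (b1 + b2 + b3) *: f.
  by rewrite !scalerDl !addrA (ACl (1*3*5*2*4*6)).
rewrite !scalerDr !scalerA collect.
have -> : (p - n)%:~R * (n + p - m)%:~R + (m - p)%:~R * (p + m - n)%:~R
          + (n - m)%:~R * (m + n - p)%:~R = 0 :> K by ring.
rewrite scale0r add0r; case: (m + (n + p) =P 0) => [mnp|_]; last first.
  by rewrite !mulr0 !addr0 scale0r.
have -> : p = - m - n by lia.
rewrite -[RHS](scale0r << VirC >>); apply: (congr1 ( *:%R^~ _)).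
by rewrite !rmorphD !rmorphN /=; field.
Qed.

Definition virasoro : lieAlgebra K :=
  LieAlgebra vir_br_alt vir_br_anti vir_jacobi.

Definition Lop (V : lieModule virasoro) (m : int) : V -> V :=
  @act K virasoro V (VirL m).

Definition eventually_locally_finite (V : lieModule virasoro) : Prop :=
  exists R : nat, forall k : int, (R%:Z <= k) -> locally_finite (@Lop V k).

Section ChargeZero.
Variables (V : lmodType K) (T : int -> V -> V).
Hypothesis T_linear : forall m, linear (T m).
Hypothesis T_br : forall m n v,
  (n - m)%:~R *: T (m + n) v = T m (T n v) - T n (T m v).

Definition vir_act0 (x : vir_basis) (v : V) : V :=
  if x is VirL m then T m v else 0.

Lemma vir_act0_linear x : linear (vir_act0 x).
Proof. by case: x => [m|] a u v /=; rewrite ?T_linear ?scaler0 ?addr0. Qed.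

Lemma vir_act0_br x y v :
  lext (vir_act0^~ v) (vir_br x y) =
    vir_act0 x (vir_act0 y v) - vir_act0 y (vir_act0 x v).
Proof.
have T0 m := linf0 (T_linear m).
case: x y => [m|] [n|] /=; rewrite ?linear0 ?T0 ?subr0 ?oppr0 ?addr0 //.
by rewrite linearP linearZ /= !lextU /= scaler0 addr0 T_br.
Qed.

Definition vir_module0 : lieModule virasoro :=
  @LieModule K virasoro V vir_act0 vir_act0_linear vir_act0_br.
End ChargeZero.

Definition nonzero := {x : K | x != 0}.

Lemma nonzero_expD (x : nonzero) m n : val x ^ (m + n) = val x ^ m * val x ^ n.
Proof. by rewrite expfzDr ?(valP x). Qed.

(* K[s, t] as polynomials in t with coefficients in K[s], seen as a K-vector
   space. *)
Definition bipoly : Type := {poly {poly K}}.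
HB.instance Definition _ := GRing.Zmodule.on bipoly.

Definition bipoly_scale (a : K) (f : bipoly) : bipoly :=
  (a%:P%:P : {poly {poly K}}) * f.

Lemma bipoly_scaleA a b f :
  bipoly_scale a (bipoly_scale b f) = bipoly_scale (a * b) f.
Proof. by rewrite /bipoly_scale mulrA -!polyCM. Qed.
Lemma bipoly_scale1 : left_id 1 bipoly_scale.
Proof. by move=> f; rewrite /bipoly_scale mul1r. Qed.
Lemma bipoly_scaleDr : right_distributive bipoly_scale +%R.
Proof. by move=> a f g; rewrite /bipoly_scale mulrDr. Qed.
Lemma bipoly_scaleDl f : {morph bipoly_scale^~ f : a b / a + b}.
Proof. by move=> a b; rewrite /bipoly_scale !polyCD mulrDl. Qed.

HB.instance Definition _ := GRing.Zmodule_isLmodule.Build K bipoly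
  bipoly_scaleA bipoly_scale1 bipoly_scaleDr bipoly_scaleDl.

Lemma phi_commutator (A : comNzRingType) (lm ln s t a h g g' F F1 F2 : A)
    (m n : int) :
  let H (k : int) := s + k%:~R * h - (k * (k - 1))%:~R * a * g in
  let H' (k : int) := k%:~R * (g' * (t - a) + g) - (k * (k - 1))%:~R * a * g' in
  let q (k : int) := k%:~R * (t - k%:~R * a) in
  let LL (k l : int) :=
    H k * ((H l - k%:~R) * F - q l * F1)
      - q k * (H' l * F + (H l - k%:~R) * F1 - (l%:~R * F1 + q l * F2)) in
  (n - m)%:~R * (lm * ln * (H (m + n) * F - q (m + n) * F1)) =
    lm * (ln * LL m n) - ln * (lm * LL n m).
Proof. by move=> H H' q LL; rewrite /LL /H /H' /q; ring. Qed.

Section Phi.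
Variables (lambda alpha : nonzero) (h : {poly K}).
Local Notation P := {poly {poly K}}.
Local Notation cst a := (a%:P%:P : P).
Local Notation s := ('X%:P : P).
Local Notation t := ('X : P).

(* p(t) in K[s, t], for p in K[t]. *)
Definition poly_t (p : {poly K}) : P := map_poly polyC p.

(* f(s, t) |-> f(s - m, t). *)
Definition shift_s (m : int) (f : P) : P :=
  map_poly (comp_poly ('X - (m%:~R)%:P)) f.

(* The division is exact, see phi_gE. *)
Definition phi_g : {poly K} :=
  (h - (h.[val alpha])%:P) %/ ('X - (val alpha)%:P).

Definition phi_L (m : int) (f : bipoly) : bipoly :=
  cst (val lambda ^ m) *
    ((s + m%:~R * poly_t h - (m * (m - 1))%:~R * cst (val alpha) * poly_t phi_g)
       * shift_s m f
     - m%:~R * (t - m%:~R * cst (val alpha)) * (shift_s m f)^`()).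

Lemma phi_gE : h = phi_g * ('X - (val alpha)%:P) + (h.[val alpha])%:P.
Proof.
rewrite divpK ?subrK // dvdp_XsubCl /root.
by rewrite hornerD hornerN hornerC subrr.
Qed.

Lemma shift_sM m : {morph shift_s m : f g / f * g}.
Proof. exact: rmorphM. Qed.

Lemma shift_s_poly_t m p : shift_s m (poly_t p) = poly_t p.
Proof.
rewrite /shift_s /poly_t -map_poly_comp; apply: eq_map_poly => a /=.
by rewrite comp_polyC.
Qed.

Lemma shift_sD m n f : shift_s m (shift_s n f) = shift_s (m + n) f.
Proof.
rewrite /shift_s -map_poly_comp; apply: eq_map_poly => p /=.
rewrite -comp_polyA; congr (_ \Po _).
by rewrite linearB /= comp_polyC comp_polyX intrD polyCD; ring.
Qed.

Lemma deriv_shift_s m f : (shift_s m f)^`() = shift_s m f^`().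
Proof. exact: deriv_map. Qed.

Lemma phi_L_linear m : linear (phi_L m).
Proof.
move=> a f g; rewrite /phi_L.
have -> : shift_s m (a *: f + g) = cst a * shift_s m f + shift_s m g.
  rewrite /shift_s rmorphD rmorphM /= map_polyC /=; congr (_%:P * _ + _).
  by rewrite comp_polyC.
rewrite derivD derivM derivC mul0r add0r.
rewrite -[RHS]/(cst a * _ + _).
ring.
Qed.

Lemma phi_L_br m n f :
  (n - m)%:~R *: phi_L (m + n) f = phi_L m (phi_L n f) - phi_L n (phi_L m f).
Proof.
have shs k : shift_s k s = s - (k%:~R : P).
  rewrite /shift_s map_polyC /= comp_polyX polyCB; congr (_ - _).
  by rewrite !rmorph_int.
have sht k : shift_s k t = t by exact: map_polyX.
have shc k c : shift_s k (cst c) = cst c.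
  by rewrite /shift_s map_polyC /= comp_polyC.
have shi k (b : int) : shift_s k b%:~R = b%:~R by exact: rmorph_int.
have shD k : {morph shift_s k : u v / u + v} by exact: rmorphD.
have shN k : {morph shift_s k : u / - u} by exact: rmorphN.
have dc c : (cst c)^`() = 0 by exact: derivC.
have ds : s^`() = 0 by exact: derivC.
have di (b : int) : (b%:~R : P)^`() = 0 by rewrite -(rmorph_int polyC) derivC.
have dmulc (c u : P) : c^`() = 0 -> (c * u)^`() = c * u^`().
  by move=> c0; rewrite derivM c0 mul0r add0r.
have dh : (poly_t h)^`() = (poly_t phi_g)^`() * (t - cst (val alpha)) + poly_t phi_g.
  rewrite {1}phi_gE /poly_t rmorphD rmorphM rmorphB /= !map_polyC /= map_polyX.
  by rewrite derivD derivM derivB derivX !derivC subr0 mulr1 addr0.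
pose H k : P := s + k%:~R * poly_t h - (k * (k - 1))%:~R * cst (val alpha) * poly_t phi_g.
pose q k : P := k%:~R * (t - k%:~R * cst (val alpha)).
pose F := shift_s (m + n) f.
have LL k l : k + l = m + n -> phi_L k (phi_L l f) =
    cst (val lambda ^ k) * (cst (val lambda ^ l) *
      (H k * ((H l - k%:~R) * F - q l * F^`())
       - q k * ((l%:~R * ((poly_t phi_g)^`() * (t - cst (val alpha)) + poly_t phi_g)
                 - (l * (l - 1))%:~R * cst (val alpha) * (poly_t phi_g)^`()) * F
                + (H l - k%:~R) * F^`() - (l%:~R * F^`() + q l * F^`()^`()))))
    :> P.
  move=> kl; rewrite /phi_L -/(H k) -/(q k) -/(H l) -/(q l).
  have sq : shift_s k (q l) = q l.
    by rewrite /q !(shift_sM, shD, shN, sht, shc, shi).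
  have sH : shift_s k (H l) = H l - k%:~R.
    by rewrite /H !(shift_sM, shD, shN, shs, shc, shi, shift_s_poly_t); ring.
  have dq : (q l)^`() = l%:~R.
    by rewrite /q dmulc // derivB derivX dmulc ?di // dc mulr0 subr0 mulr1.
  have dH : (H l - k%:~R)^`() =
      l%:~R * ((poly_t phi_g)^`() * (t - cst (val alpha)) + poly_t phi_g)
      - (l * (l - 1))%:~R * cst (val alpha) * (poly_t phi_g)^`().
    rewrite /H !derivB derivD ds di add0r subr0 dmulc // dh -!mulrA.
    by rewrite dmulc // dmulc.
  move: sq sH dq dH.
  move: (q l) (q k) (H l) (H k) => ql qk Hl Hk sq sH dq dH.
  rewrite !(shift_sM, shD, shN) shc -deriv_shift_s !shift_sD kl -/F sq sH.
  rewrite dmulc // [(_ - _)^`()]derivB !derivM dq dH; ring.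
rewrite -[LHS]/((cst (n - m)%:~R * phi_L (m + n) f) : P) -[RHS]/((_ : P) - _).
rewrite (LL m n erefl) (LL n m (addrC n m)) !rmorph_int /phi_L nonzero_expD.
rewrite !polyCM; exact: (phi_commutator _ _ _ _ _ _ _ (poly_t phi_g)^`()).
Qed.

Definition Phi : lieModule virasoro := vir_module0 phi_L_linear phi_L_br.
End Phi.

Section Omega.
Variables (mu : nonzero) (b : K).

Definition omega_L (n : int) (f : {poly K}) : {poly K} :=
  val mu ^ n *: ((f \Po ('X - (n%:~R)%:P)) * ('X + (n%:~R * (b - 1))%:P)).

Lemma omega_L_linear n : linear (omega_L n).
Proof.
move=> a f g; rewrite /omega_L comp_polyD comp_polyZ mulrDl -scalerAl.
by rewrite scalerDr !scalerA mulrC.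
Qed.

Lemma omega_L_br m n f :
  (n - m)%:~R *: omega_L (m + n) f =
    omega_L m (omega_L n f) - omega_L n (omega_L m f).
Proof.
have LL k l : k + l = m + n -> omega_L k (omega_L l f) =
    (val mu ^ k * val mu ^ l) *: ((f \Po ('X - ((m + n)%:~R)%:P)) *
      (('X - (k%:~R)%:P + (l%:~R * (b - 1))%:P)
        * ('X + (k%:~R * (b - 1))%:P))).
  move=> <-; rewrite /omega_L comp_polyZ comp_polyM -scalerAl scalerA -mulrA.
  rewrite -comp_polyA comp_polyB comp_polyD comp_polyX !comp_polyC.
  by rewrite intrD polyCD opprD addrA.
rewrite (LL m n erefl) (LL n m (addrC n m)) /omega_L nonzero_expD.
rewrite [val mu ^ n * _]mulrC -scalerBr -mulrBr.
have -> : ('X - m%:~R%:P + (n%:~R * (b - 1))%:P) * ('X + (m%:~R * (b - 1))%:P)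
    - ('X - n%:~R%:P + (m%:~R * (b - 1))%:P) * ('X + (n%:~R * (b - 1))%:P)
    = (n - m)%:~R *: ('X + ((m + n)%:~R * (b - 1))%:P).
  rewrite -mul_polyC !(polyCM, intrD, intrN, polyCD, polyCN) polyC1; ring.
by rewrite -scalerAr !scalerA mulrC.
Qed.

Definition Omega : lieModule virasoro := vir_module0 omega_L_linear omega_L_br.
End Omega.

(* A module over K[t^{+-1}, t d/dt], given by the actions of the t^n and of
   t d/dt; these generate the algebra, with the relations lmon0, lmonD and
   eulerD. *)
Record laurentDModule := LaurentDModule {
  ld_carrier :> lmodType K;
  lmon : int -> ld_carrier -> ld_carrier;
  euler : ld_carrier -> ld_carrier;
  lmon_linear : forall n, linear (lmon n);
  euler_linear : linear euler;
  lmon0 : forall w, lmon 0 w = w;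
  lmonD : forall m n w, lmon (m + n) w = lmon m (lmon n w);
  eulerD : forall n w, euler (lmon n w) = lmon n (euler w) + n%:~R *: lmon n w }.

Definition ld_irreducible (A : laurentDModule) : Prop :=
  (exists w : A, w != 0) /\
  forall S : {pred A}, submod_closed S ->
    (forall n w, w \in S -> lmon n w \in S) ->
    (forall w, w \in S -> euler w \in S) ->
    (forall w, w \in S -> w = 0) \/ (forall w, w \in S).

Section Intermediate.
Variables (A : laurentDModule) (b : K).

Definition interm_L (n : int) (w : A) : A :=
  lmon n (euler w) + (n%:~R * b) *: lmon n w.

Lemma interm_L_linear n : linear (interm_L n).
Proof.
move=> a u v; rewrite /interm_L euler_linear !lmon_linear !scalerDr addrACA.
by rewrite !scalerA [a * _]mulrC.
Qed.

Lemma interm_L_br m n w :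
  (n - m)%:~R *: interm_L (m + n) w =
    interm_L m (interm_L n w) - interm_L n (interm_L m w).
Proof.
have lD k := linfD (@lmon_linear A k).
have lZ k a := linfZ (@lmon_linear A k) a.
have eD := linfD (@euler_linear A).
have eZ a := linfZ (@euler_linear A) a.
have LL k l : k + l = m + n -> interm_L k (interm_L l w) =
    lmon (m + n) (euler (euler w))
    + (l%:~R + (l%:~R + k%:~R) * b) *: lmon (m + n) (euler w)
    + (l%:~R * l%:~R * b + k%:~R * l%:~R * b * b) *: lmon (m + n) w.
  move=> <-; rewrite /interm_L eD eZ !eulerD !(lD, lZ) -!lmonD.
  rewrite !scalerDr !scalerA !addrA.
  set u := lmon _ (euler (euler w)); set v := lmon _ (euler w).
  set z := lmon _ w.
  rewrite (ACl (1*(2*3*5)*(4*6))) /= -!scalerDl.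
  by congr (_ + _ *: _ + _ *: _); ring.
rewrite (LL m n erefl) (LL n m (addrC n m)) /interm_L scalerDr scalerA.
set u := lmon _ (euler (euler w)); set v := lmon _ (euler w); set z := lmon _ w.
rewrite !opprD !addrA (ACl (1*4*(2*5)*(3*6))) /= subrr add0r -!scalerBl.
by congr (_ *: _ + _ *: _); rewrite ?rmorphD ?rmorphN /=; ring.
Qed.

Definition Intermediate : lieModule virasoro :=
  vir_module0 interm_L_linear interm_L_br.
End Intermediate.

(* a_r = V_+ / V_r has basis \bar L_0, ..., \bar L_r, and \bar L_k = 0 for
   k > r. *)
Section TruncatedVirasoro.
Variable r : nat.

Definition trunc_br (i j : 'I_r.+1) : {malg K['I_r.+1]} :=
  if (i + j <= r)%N then (j%:Z - i%:Z)%:~R *: << inord (i + j) >> else 0.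

Lemma trunc_br_alt i : trunc_br i i = 0.
Proof. by rewrite /trunc_br subrr scale0r if_same. Qed.

Lemma trunc_br_anti i j : trunc_br i j = - trunc_br j i.
Proof.
rewrite /trunc_br (addnC j i); case: (i + j <= r)%N; last exact: (esym (oppr0 _)).
have -> : (j%:Z - i%:Z)%:~R = - (i%:Z - j%:Z)%:~R :> K by rewrite -rmorphN opprB.
exact: scaleNr.
Qed.

Lemma trunc_jacobi i j k :
  lext (trunc_br i) (trunc_br j k) + lext (trunc_br j) (trunc_br k i)
    + lext (trunc_br k) (trunc_br i j) = 0.
Proof.
have h (x y z : 'I_r.+1) w : (x + y + z)%N = w ->
    lext (trunc_br x) (trunc_br y z) =
    (if (w <= r)%N
     then (z%:~R - y%:~R) * (y%:~R + z%:~R - x%:~R) else 0) *: << inord w >>.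
  move=> <-; rewrite [trunc_br y z]/trunc_br; case: ifPn => [yz|yzN]; last first.
    rewrite ifN; first by rewrite scale0r; exact: raddf0.
    by apply: contra yzN; apply: leq_trans; rewrite -addnA leq_addl.
  apply: (etrans (linfZ (lext_linear _) _ _)).
  rewrite lextU /trunc_br (@inordK r (y + z) yz) addnA.
  case: (x + y + z <= r)%N; last by rewrite scale0r; exact: scaler0.
  by rewrite scalerA PoszD !rmorphB rmorphD.
have [e1 e2] : (j + k + i = i + j + k /\ k + i + j = i + j + k)%N by lia.
apply: (etrans (congr2 +%R (congr2 +%R (h i j k _ erefl) (h j k i _ e1)) (h k i j _ e2))).
rewrite -!scalerDl -[RHS](scale0r << inord (i + j + k) >>).
apply: (congr1 ( *:%R^~ _)).
by case: ifP => _; ring.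
Qed.

Definition trunc_virasoro : lieAlgebra K :=
  LieAlgebra trunc_br_alt trunc_br_anti trunc_jacobi.

Definition Lbar (M : lieModule trunc_virasoro) (i : 'I_r.+1) : M -> M :=
  @act K trunc_virasoro M i.

Section LoopModule.
Variables (M : lieModule trunc_virasoro) (gamma : {poly K}).
Local Notation laurent := {malg K[int]}.

(* t^k gamma(t) in K[t^{+-1}], where << k >> is t^k. *)
Definition laurent_mul (k : int) : laurent :=
  \sum_(j < size gamma) gamma`_j *: << k + j%:Z >>.

Definition loop_X (n : int) (v : M) : M :=
  \sum_(i < r.+1) (n%:~R ^+ i.+1 / (i.+1)`!%:R) *: Lbar i v.

(* The image of v (x) t^k under L_n. *)
Definition loop_pure (n : int) (v : M) (k : int) : tensor M laurent :=
  tens (k%:~R *: v + loop_X n v) << n + k >> + tens v (laurent_mul (n + k)).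

Definition loop_L (n : int) : tensor M laurent -> tensor M laurent :=
  tlift (fun v => lext (loop_pure n v)).

Lemma loop_X_linear n : linear (loop_X n).
Proof.
move=> a u v; rewrite /loop_X scaler_sumr -big_split; apply: eq_bigr => i _ /=.
by rewrite /Lbar act_linear scalerDr !scalerA [a * _]mulrC.
Qed.

Lemma tens_linear2 (W : lmodType K) (X : M -> M) (e f : W) :
  linear X -> linear (fun v => tens (X v) e + tens v f).
Proof.
by move=> lX a u v; rewrite lX !tens_linearl scalerDr addrACA.
Qed.

Lemma loop_pure_linear n k : linear (fun v => loop_pure n v k).
Proof.
apply: (@tens_linear2 _ (fun v => k%:~R *: v + loop_X n v)) => a u v.
by rewrite (loop_X_linear n) !scalerDr !scalerA [k%:~R * a]mulrC addrACA.
Qed.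

Lemma lext_linear_fun (V : lmodType K) (f : M -> int -> V) (p : laurent) :
  (forall k, linear (f^~ k)) -> linear (fun v => lext (f v) p).
Proof.
move=> lf a u v; rewrite /lext scaler_sumr -big_split; apply: eq_bigr => k _ /=.
by rewrite (lf k) scalerDr !scalerA [p@_k * a]mulrC.
Qed.

Lemma loop_lext_linearl n p : linear (fun v => lext (loop_pure n v) p).
Proof. exact: lext_linear_fun (loop_pure_linear n). Qed.

Lemma loop_L_linear n : linear (loop_L n).
Proof.
exact: (tlift_linear (loop_lext_linearl n) (fun v => lext_linear (loop_pure n v))).
Qed.

Lemma loop_LE n v k :
  loop_L n (tens v << k >>) =
    tens (k%:~R *: v + loop_X n v) << n + k >> + tens v (laurent_mul (n + k)).
Proof.
apply: etrans (lextU (loop_pure n v) k).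
exact: (tliftE (loop_lext_linearl n) (fun v => lext_linear (loop_pure n v))).
Qed.

Definition egf (x : K) (i : nat) : K := x ^+ i / i`!%:R.

Lemma egfS x i : i.+1%:R * egf x i.+1 = x * egf x i.
Proof.
have i0 : i`!%:R != 0 :> K by rewrite pnatr_eq0 -lt0n fact_gt0.
have iS : i.+1%:R != 0 :> K by rewrite pnatr_eq0.
rewrite /egf factS natrM exprS; move: i.+1%:R i`!%:R i0 iS => c d d0 c0.
by field; rewrite d0 c0.
Qed.

Lemma egf0 x : egf x 0 = 1.
Proof. by rewrite /egf fact0 divr1 expr0. Qed.

Lemma egfD x y N :
  egf (x + y) N = \sum_(i < N.+1) egf x i * egf y (N - i).
Proof.
rewrite /egf addrC exprDn mulr_suml; apply: eq_bigr => i _.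
have iN : (i <= N)%N by rewrite -ltnS.
have nz k : k`!%:R != 0 :> K by rewrite pnatr_eq0 -lt0n fact_gt0.
rewrite -mulr_natr.
have -> : 'C(N, i)%:R = N`!%:R / (i`!%:R * (N - i)`!%:R) :> K.
  by rewrite -(bin_fact iN) !natrM mulfK // mulf_neq0.
by field; rewrite !nz.
Qed.

Lemma egf_conv x y N :
  \sum_(i < N.+1) egf x i.+1 * egf y (N - i).+1 * ((N - i)%:R - i%:R) =
    (y - x) * egf (x + y) N.+1 - y * egf y N.+1 + x * egf x N.+1.
Proof.
have Sx : \sum_(i < N.+1) (i.+1%:R * egf x i.+1) * egf y (N - i).+1 =
    x * egf (x + y) N.+1 - x * egf x N.+1.
  apply/eqP; rewrite -subr_eq opprK; apply/eqP.
  rewrite egfD mulr_sumr [RHS]big_ord_recr /= subnn egf0 mulr1; congr (_ + _).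
  by apply: eq_bigr => i _; rewrite egfS mulrA subSn // -ltnS.
have Sy : \sum_(i < N.+1) egf x i.+1 * ((N - i).+1%:R * egf y (N - i).+1) =
    y * egf (x + y) N.+1 - y * egf y N.+1.
  apply/eqP; rewrite -subr_eq opprK; apply/eqP.
  rewrite egfD mulr_sumr [RHS]big_ord_recl /= subn0 egf0 mul1r addrC.
  by congr (_ + _); apply: eq_bigr => i _; rewrite egfS mulrCA /bump add1n subSS.
transitivity ((y * egf (x + y) N.+1 - y * egf y N.+1)
              - (x * egf (x + y) N.+1 - x * egf x N.+1)); last by ring.
rewrite -Sx -Sy -sumrB; apply: eq_bigr => i _.
by rewrite -[i.+1%:R]natr1 -[_.+1%:R]natr1; ring.
Qed.

Definition Lnat (v : M) (k : nat) : M :=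
  if (k <= r)%N then Lbar (inord k) v else 0.

Lemma Lbar_br i j v :
  Lbar i (Lbar j v) - Lbar j (Lbar i v) = (j%:R - i%:R) *: Lnat v (i + j).
Proof.
rewrite /Lbar -act_br /= /trunc_br /Lnat.
case: ifP => _; last by rewrite raddf0 scaler0.
by rewrite linearZ /= lextU rmorphB.
Qed.

Lemma sum_diag (f : nat -> nat -> K) v :
  \sum_(i < r.+1) \sum_(j < r.+1) f i j *: Lnat v (i + j) =
  \sum_(k < r.+1) (\sum_(i < k.+1) f i (k - i)%N) *: Lnat v k.
Proof.
transitivity (\sum_(i < r.+1) \sum_(k < r.+1 | (i <= k)%N)
    f i (k - i)%N *: Lnat v k).
  apply: eq_bigr => i _.
  rewrite -(big_mkord xpredT (fun j => f i j *: Lnat v (i + j))).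
  rewrite -(big_mkord (fun k => (i <= k)%N) (fun k => f i (k - i)%N *: Lnat v k)).
  rewrite (@big_cat_nat _ _ _ (r.+1 - i)) //= ?leq_subr //.
  rewrite [X in _ + X]big_nat_cond [X in _ + X]big1 ?addr0; last first.
    move=> j /andP[/andP[h _] _]; rewrite /Lnat ifN ?scaler0 //.
    by rewrite -ltnNge -leq_subLR.
  rewrite [RHS](@big_cat_nat _ _ _ i) //=; last exact: ltnW.
  rewrite [X in X + _]big_nat_cond [X in X + _]big_pred0 ?add0r; last first.
    by move=> j; apply/negP => /andP[/andP[_ h1] h2]; lia.
  have sh := @big_addn M 0 +%R 0%N r.+1 i (fun k => (i <= k)%N)
    (fun k => f i (k - i)%N *: Lnat v k).
  rewrite add0n in sh; rewrite sh.
  apply: eq_big => [j|j _]; first by rewrite leq_addl.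
  by rewrite addnK addnC.
rewrite (exchange_big_dep xpredT) //=; apply: eq_bigr => k _.
rewrite scaler_suml -(big_mkord xpredT (fun i => f i (k - i)%N *: Lnat v k)).
rewrite -(big_mkord (fun i => (i <= k)%N) (fun i => f i (k - i)%N *: Lnat v k)).
by rewrite [RHS](big_nat_widen _ _ _ _ _ (ltn_ord k)).
Qed.

Lemma loop_X_br m n v :
  loop_X m (loop_X n v) - loop_X n (loop_X m v) =
    (n - m)%:~R *: loop_X (m + n) v - n%:~R *: loop_X n v + m%:~R *: loop_X m v.
Proof.
pose e (k : int) i := egf k%:~R i.+1.
have XE k u : loop_X k u = \sum_(i < r.+1) e k i *: Lbar i u by [].
have lLbar i : linear (@Lbar M i) := @act_linear K trunc_virasoro M i.
have XX k l : loop_X k (loop_X l v) =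
    \sum_(i < r.+1) \sum_(j < r.+1) (e k i * e l j) *: Lbar i (Lbar j v).
  rewrite XE; apply: eq_bigr => i _; rewrite XE.
  rewrite (linf_sum (lLbar i)) scaler_sumr; apply: eq_bigr => j _.
  by rewrite (linfZ (lLbar i)) scalerA.
have -> : loop_X m (loop_X n v) - loop_X n (loop_X m v) =
   \sum_(i < r.+1) \sum_(j < r.+1) (e m i * e n j * (j%:R - i%:R)) *: Lnat v (i + j).
  rewrite !XX [X in _ - X]exchange_big /= -sumrB; apply: eq_bigr => i _.
  rewrite -sumrB; apply: eq_bigr => j _.
  by rewrite [e n j * _]mulrC -scalerBr Lbar_br scalerA.
rewrite (sum_diag (fun i j => e m i * e n j * (j%:R - i%:R))).
rewrite !XE !scaler_sumr -sumrB -big_split; apply: eq_bigr => k _ /=.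
rewrite /e egf_conv /Lnat -ltnS ltn_ord inord_val !scalerA -scalerBl -scalerDl.
by rewrite !rmorphD rmorphN.
Qed.

Lemma loop_br_abstract (W : lmodType K) (L : int -> tensor M W -> tensor M W)
    (S : int -> W -> W) (E : W -> W) :
  (forall k, linear (L k)) -> (forall k, linear (S k)) ->
  (forall k l w, S k (S l w) = S (k + l) w) ->
  (forall k w, E (S k w) = S k (E w) + k%:~R *: S k w) ->
  (forall k v w, L k (tens v w) = tens (loop_X k v) (S k w) + tens v (S k (E w))) ->
  forall m n x, (n - m)%:~R *: L (m + n) x = L m (L n x) - L n (L m x).
Proof.
move=> lL lS SS ES LE m n.
apply: tensor_lin_ext => [a u v|a u v|v w].
- by rewrite (lL (m + n)) scalerDr !scalerA mulrC.
- by rewrite !lL scalerBr opprD addrACA.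
have tlD (u : M) := linfD (@tens_linearr _ M W u).
have tlZ (u : M) a := linfZ (@tens_linearr _ M W u) a.
have LL k l : k + l = m + n -> L k (L l (tens v w)) =
    tens (loop_X k (loop_X l v)) (S (m + n) w)
    + (tens (loop_X l v) (S (m + n) (E w)) + tens (loop_X k v) (S (m + n) (E w)))
    + l%:~R *: tens (loop_X l v) (S (m + n) w)
    + tens v (S (m + n) (E (E w))) + l%:~R *: tens v (S (m + n) (E w)).
  move=> <-; rewrite LE (linfD (lL k)) !LE !ES !(linfD (lS k)) !(linfZ (lS k)).
  rewrite !SS !tlD !tlZ !addrA.
  by rewrite (ACl (1*(2*4)*3*5*6)) /= !addrA.
rewrite (LL m n erefl) (LL n m (addrC n m)) LE scalerDr.
have -> : (n - m)%:~R *: tens (loop_X (m + n) v) (S (m + n) w) =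
   tens (loop_X m (loop_X n v)) (S (m + n) w)
   - tens (loop_X n (loop_X m v)) (S (m + n) w)
   + n%:~R *: tens (loop_X n v) (S (m + n) w)
   - m%:~R *: tens (loop_X m v) (S (m + n) w).
  have lt := @tens_linearl _ M W (S (m + n) w).
  have tB : {morph (@tens _ M W)^~ (S (m + n) w) : a b / a - b} := linfB lt.
  have tD : {morph (@tens _ M W)^~ (S (m + n) w) : a b / a + b} := linfD lt.
  have tZ a : {morph (@tens _ M W)^~ (S (m + n) w) : u / a *: u} := linfZ lt a.
  rewrite -!tZ -!(tB, tD) loop_X_br; congr tens.
  by rewrite [RHS](ACl (1*(2*4)*(3*5))) /= addNr subrr !addr0.
set a1 := tens (loop_X m (loop_X n v)) _; set a2 := tens (loop_X n (loop_X m v)) _.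
set b1 := tens (loop_X n v) (S _ (E _)); set b2 := tens (loop_X m v) (S _ (E _)).
set c1 := _ *: tens (loop_X n v) _; set c2 := _ *: tens (loop_X m v) _.
set d := tens v (S _ (E (E w))); set x := tens v _.
rewrite rmorphB /= scalerBl (addrC b2 b1); move: (b1 + b2) => b.
move: a1 a2 b c1 c2 d (n%:~R *: x) (m%:~R *: x) => a1 a2 {b1 b2}b {}c1 {}c2 {}d x1 x2.
by rewrite !opprD !addrA [RHS](ACl (1*6*3*8*5*10*(2*7)*(4*9))) /= !subrr !addr0.
Qed.

Lemma loop_L_br m n x :
  (n - m)%:~R *: loop_L (m + n) x =
    loop_L m (loop_L n x) - loop_L n (loop_L m x).
Proof.
pose S k : laurent -> laurent := lext (fun l => << k + l >>).
pose E : laurent -> laurent := lext (fun k => k%:~R *: << k >> + laurent_mul k).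
have lS k : linear (S k) by exact: lext_linear.
have lE : linear E by exact: lext_linear.
have SU k l : S k << l >> = << k + l >> by exact: lextU.
have EU k : E << k >> = k%:~R *: << k >> + laurent_mul k by exact: lextU.
have SS k l w : S k (S l w) = S (k + l) w.
  move: w; apply: malg_lin_ext => [a u v|a u v|i].
  - by rewrite (lS l) (lS k).
  - exact: lS.
  - by rewrite !SU addrA.
have Smul k l : S k (laurent_mul l) = laurent_mul (k + l).
  rewrite /laurent_mul (linf_sum (lS k)); apply: eq_bigr => j _.
  by rewrite (linfZ (lS k)) SU addrA.
have ES k w : E (S k w) = S k (E w) + k%:~R *: S k w.
  move: w; apply: malg_lin_ext => [||i].
  - exact: (lin_comp lE (lS k)).
  - exact: (lin_add (lin_comp (lS k) lE) (lin_scale _ (lS k))).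
  rewrite SU !EU (linfD (lS k)) (linfZ (lS k)) SU Smul addrAC -scalerDl.
  by rewrite rmorphD /= [k%:~R + _]addrC.
have LE k v w : loop_L k (tens v w) = tens (loop_X k v) (S k w) + tens v (S k (E w)).
  move: w; apply: malg_lin_ext => [||i].
  - exact: (lin_comp (loop_L_linear k) (tens_linearr v)).
  - exact: (lin_add (lin_comp (tens_linearr _) (lS k))
                    (lin_comp (tens_linearr _) (lin_comp (lS k) lE))).
  rewrite loop_LE SU EU (linfD (lS k)) (linfZ (lS k)) SU Smul.
  rewrite (linfD (@tens_linearr _ _ _ v)) (linfZ (@tens_linearr _ _ _ v)).
  rewrite addrA (linfD (@tens_linearl _ _ _ _)) (linfZ (@tens_linearl _ _ _ _)).
  by rewrite [tens (loop_X k v) _ + _]addrC.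
exact: (loop_br_abstract loop_L_linear lS SS ES LE).
Qed.

Definition LoopModule : lieModule virasoro := vir_module0 loop_L_linear loop_L_br.
End LoopModule.
End TruncatedVirasoro.

End Virasoro.

(* Main.v *)
(* A tensor product whose first factor is Phi = Phi(lambda, alpha, h) has the
   form Phi (x) U, and is graded by the coordinates of its elements on the basis
   t^i s^j of Phi.  Every L_k raises the s-degree by exactly one, so no L_k is
   locally finite, which excludes V'.

   On N(M, gamma) and A_b' the vector L_{l-m} L_m x is a polynomial in m.  On
   Phi (x) U, the cross terms of L_{l-m} L_m (1 (x) u) then force
   a_m = lambda^{-m} L_m u to be a polynomial in m of degree bounded
   independently of u, and m a_m = [L_0, a_m] brings this degree down until
   L_m u = 0.  So U is a trivial module, and Phi itself is distinguished from
   A_b' by the term m^4 of L_{-m} L_m, and from N(M, gamma) by the sequence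
   n |-> L_n (v (x) 1), in which the powers of t are unbounded.

   For the last family, all the L_k with k large annihilate any given vector of
   V or V', by a theorem of Mazorchuk and Zhao.  Hence k |-> L_k w is ultimately
   an exponential polynomial: the part at lambda_1 has degree at least 2 for
   every w <> 0 in the first module, whereas for w = 1 (x) ... (x) 1 (x) v' no
   part has degree greater than 1. *)

Require Import Defs.
From mathcomp Require Import all_boot all_order all_algebra.
From mathcomp Require Import boolp reals complex.
From mathcomp.multinomials Require Import monalg.
From mathcomp Require Import ring zify.

Import Order.TTheory GRing.Theory Num.Theory.
Local Open Scope ring_scope.

Set Implicit Arguments.
Unset Strict Implicit.
Unset Printing Implicit Defensive.

(** * Sequences and the shift operator *)

Lemma lin_sub (K : fieldType) (U V : lmodType K) (f g : U -> V) :
  linear f -> linear g -> linear (fun u => f u - g u).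
Proof. by move=> lf lg a u v; rewrite lf lg scalerBr opprD addrACA. Qed.

(** A scalar multiple of a pure tensor is again pure, so sums of pure tensors exhaust the tensor
    product. *)
Lemma tensor_ind (K : fieldType) (V W : lmodType K) (P : tensor V W -> Prop) :
  (forall x y, P x -> P y -> P (x + y)) -> (forall v w, P (tens v w)) ->
  forall x, P x.
Proof.
move=> PD Pt x.
have P0 : P 0 by rewrite -(linf0 (@tens_linearl K V W 0)); exact: Pt.
rewrite -[x]treprK [trepr x]monalgE (linf_sum (@tproj_linear K V W)).
apply: big_ind => // [[v w]] _.
have -> : << (trepr x)@_(v, w) *g (v, w) >> =
    (trepr x)@_(v, w) *: << (v, w) >> :> {malg K[(V * W)%type]}.
  apply/malgP=> k; rewrite mcoeffZ !mcoeffU.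
  by case: eqP; rewrite ?mulr1n ?mulr0n ?mulr1 ?mulr0.
rewrite (linfZ (@tproj_linear K V W)) -/(tens v w).
by rewrite -(linfZ (@tens_linearl K V W w)); exact: Pt.
Qed.

Section ShiftOperator.
Variables (K : numFieldType) (U : lmodType K).
Implicit Types (a b : int -> U) (rho : K) (d : nat).

(** The operator S - rho, for S the shift of sequences. *)
Definition dop rho a : int -> U := fun k => a (k + 1) - rho *: a k.

(* For rho <> 0: a k is rho ^ k times a polynomial in k of degree < d. *)
Definition killed rho d a := forall k, iter d (dop rho) a k = 0.

Lemma eq_dop rho a b : a =1 b -> dop rho a =1 dop rho b.
Proof. by move=> ab k; rewrite /dop !ab. Qed.

Lemma eq_iter_dop rho d a b : a =1 b -> iter d (dop rho) a =1 iter d (dop rho) b.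
Proof. by move=> ab; elim: d => //= d; exact: eq_dop. Qed.

Lemma eq_killed rho d a b : a =1 b -> killed rho d a -> killed rho d b.
Proof. by move=> ab ha k; rewrite -(eq_iter_dop rho d ab). Qed.

Lemma dop_lincomb rho c a b :
  dop rho (fun k => c *: a k + b k) =1 fun k => c *: dop rho a k + dop rho b k.
Proof.
move=> k; rewrite /dop scalerDr scalerBr opprD !scalerA [rho * c]mulrC.
by rewrite addrACA.
Qed.

Lemma iter_dop_lincomb rho d c a b :
  iter d (dop rho) (fun k => c *: a k + b k) =1
  fun k => c *: iter d (dop rho) a k + iter d (dop rho) b k.
Proof.
elim: d => //= d IHd k; rewrite (eq_dop _ IHd); exact: dop_lincomb.
Qed.

Lemma killed_lincomb rho d c a b :
  killed rho d a -> killed rho d b -> killed rho d (fun k => c *: a k + b k).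
Proof.
by move=> ha hb k; rewrite iter_dop_lincomb ha hb scaler0 addr0.
Qed.

Lemma killed0 rho d : killed rho d (fun=> 0).
Proof.
elim: d => [|d IHd] k; first by [].
rewrite iterSr (eq_iter_dop rho d (b := fun=> 0)) ?IHd // => j.
by rewrite /dop scaler0 subr0.
Qed.

Lemma killedD rho d a b :
  killed rho d a -> killed rho d b -> killed rho d (fun k => a k + b k).
Proof.
move=> ha hb; apply: eq_killed (killed_lincomb 1 ha hb) => k.
by rewrite scale1r.
Qed.

Lemma killedZ rho d c a : killed rho d a -> killed rho d (fun k => c *: a k).
Proof.
move=> ha; apply: eq_killed (killed_lincomb c ha (killed0 rho d)) => k.
by rewrite addr0.
Qed.

Lemma killedB rho d a b :
  killed rho d a -> killed rho d b -> killed rho d (fun k => a k - b k).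
Proof.
move=> ha hb; apply: eq_killed (killed_lincomb (-1) hb ha) => k.
by rewrite scaleN1r addrC.
Qed.

Lemma killed_sum rho d (I : Type) (r : seq I) (F : I -> int -> U) :
  (forall i, killed rho d (F i)) -> killed rho d (fun k => \sum_(i <- r) F i k).
Proof.
move=> hF; elim: r => [|i r IHr].
  by apply: eq_killed (killed0 rho d) => k; rewrite big_nil.
by apply: eq_killed (killedD (hF i) IHr) => k; rewrite big_cons.
Qed.

Lemma killed_leq rho d e a : (d <= e)%N -> killed rho d a -> killed rho e a.
Proof.
move=> /subnK <- ha k; rewrite iterD.
rewrite (eq_iter_dop _ _ (b := fun=> 0)); first exact: killed0.
exact: ha.
Qed.

Lemma iter_dop_shift rho d a c k :
  iter d (dop rho) (fun j => a (j + c)) k = iter d (dop rho) a (k + c).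
Proof.
elim: d a k => [|d IHd] a k //; rewrite !iterSr -IHd.
by apply: eq_iter_dop => j; rewrite /dop addrAC.
Qed.

Lemma killed_const (x : U) : killed 1 1 (fun=> x).
Proof. by move=> k; rewrite /= /dop scale1r subrr. Qed.

Lemma dop_mulX rho a k :
  dop rho (fun j => j%:~R *: a j) k = k%:~R *: dop rho a k + a (k + 1).
Proof.
rewrite /dop rmorphD /= scalerDl scale1r scalerBr !scalerA [rho * _]mulrC.
by rewrite addrAC.
Qed.

(** Leibniz rule: (S - rho)^(d+1) commutes with multiplication by k up to the term (d+1) (S - rho)^d
    S. *)
Lemma iter_dop_mulX rho d a k :
  iter d.+1 (dop rho) (fun j => j%:~R *: a j) k =
  k%:~R *: iter d.+1 (dop rho) a k + d.+1%:R *: iter d (dop rho) a (k + 1).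
Proof.
elim: d k => [|d IHd] k; first by rewrite /= dop_mulX scale1r.
rewrite [LHS]/= (eq_dop _ IHd).
set x := iter d.+1 (dop rho) a; set y := iter d (dop rho) a.
rewrite -[iter d.+2 _ _]/(dop rho x).
transitivity (dop rho (fun j => j%:~R *: x j) k +
              d.+1%:R *: dop rho (fun j => y (j + 1)) k).
  rewrite addrC.
  have e : dop rho (fun k0 => k0%:~R *: x k0 + d.+1%:R *: y (k0 + 1)) =1
           dop rho (fun k0 => d.+1%:R *: y (k0 + 1) + k0%:~R *: x k0).
    by apply: eq_dop => j; rewrite addrC.
  by rewrite e dop_lincomb.
rewrite dop_mulX -addrA; congr (_ + _).
have -> : dop rho (fun j => y (j + 1)) k = x (k + 1).
  by rewrite /x iterS -/y /dop.
by rewrite -{1}[x (k + 1)]scale1r -scalerDl addrC natr1.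
Qed.

Lemma killed_mulX rho d a :
  killed rho d a -> killed rho d.+1 (fun k => k%:~R *: a k).
Proof.
move=> ha k; rewrite iter_dop_mulX ha scaler0 addr0.
by rewrite (killed_leq (leqnSn d) ha) scaler0.
Qed.

Lemma killed_geom rho x : rho != 0 -> killed rho 1 (fun k => rho ^ k *: x).
Proof.
move=> r0 k; rewrite /= /dop expfzDr // expr1z scalerA mulrC subrr //.
Qed.

End ShiftOperator.

Lemma linear_iter_dop (K : numFieldType) (U V : lmodType K) (f : U -> V) rho d a :
  linear f -> iter d (dop rho) (fun k => f (a k)) =1
              fun k => f (iter d (dop rho) a k).
Proof.
move=> lf; elim: d => //= d IHd k; rewrite (eq_dop _ IHd).
by rewrite /dop (linfB lf) (linfZ lf).
Qed.

Lemma linear_killed (K : numFieldType) (U V : lmodType K) (f : U -> V) rho d a :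
  linear f -> killed rho d a -> killed rho d (fun k => f (a k)).
Proof. by move=> lf ha k; rewrite linear_iter_dop // ha (linf0 lf). Qed.

Lemma killed_inj (K : numFieldType) (U V : lmodType K) (f : U -> V) rho d a :
  linear f -> injective f -> killed rho d (fun k => f (a k)) -> killed rho d a.
Proof.
move=> lf fI ha k; apply: fI; rewrite (linf0 lf) -(ha k).
by rewrite (linear_iter_dop _ _ _ lf).
Qed.

(** * The part of a sequence at one ratio, up to finitely many terms *)

Section EventuallyKilled.
Variables (K : numFieldType) (U : lmodType K).
Implicit Types (a b : int -> U) (rho : K) (d : nat).

(** A monic polynomial in S, given by the list of its roots with multiplicity. *)
Definition dops (rs : seq K) (a : int -> U) : int -> U := foldr (@dop K U) a rs.

Lemma eq_dops rs a b : a =1 b -> dops rs a =1 dops rs b.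
Proof. by move=> ab; elim: rs => //= r rs; exact: eq_dop. Qed.

Lemma dopC r s a : dop r (dop s a) =1 dop s (dop r a).
Proof.
move=> k; rewrite /dop !scalerBr !scalerA [r * s]mulrC !opprB !addrA.
by rewrite [LHS]addrAC -!addrA; congr (_ + _); rewrite addrC -!addrA;
   congr (_ + _); rewrite addrC.
Qed.

Lemma dops_dopC r rs a : dops rs (dop r a) =1 dop r (dops rs a).
Proof.
elim: rs => //= s rs IHrs k; rewrite (eq_dop _ IHrs); exact: dopC.
Qed.

Lemma dops_cat rs ss a : dops (rs ++ ss) a = dops rs (dops ss a).
Proof. exact: foldr_cat. Qed.

Lemma dops_catC rs ss a : dops (rs ++ ss) a =1 dops (ss ++ rs) a.
Proof.
elim: rs => [|r rs IHrs] k /=; first by rewrite cats0.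
by rewrite (eq_dop _ IHrs) !dops_cat -dops_dopC.
Qed.

Lemma dops_lincomb rs c a b :
  dops rs (fun k => c *: a k + b k) =1 fun k => c *: dops rs a k + dops rs b k.
Proof.
elim: rs => //= r rs IHrs k; rewrite (eq_dop _ IHrs); exact: dop_lincomb.
Qed.

Definition eventually0 a := exists N : int, forall k, N <= k -> a k = 0.

Lemma eventually0_dops rs a : eventually0 a -> eventually0 (dops rs a).
Proof.
case=> N hN; exists N; elim: rs => //= r rs IHrs k Nk.
by rewrite /dop !IHrs ?scaler0 ?subrr //; lia.
Qed.

Lemma eventually0D a b c :
  eventually0 a -> eventually0 b -> eventually0 (fun k => c *: a k + b k).
Proof.
move=> [M hM] [N hN]; exists (Num.max M N) => k; rewrite ge_max => /andP[h1 h2].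
by rewrite hM // hN // scaler0 addr0.
Qed.

(* Some Q(S) (S - lam)^d, where S is the shift and Q(lam) <> 0, eventually
   annihilates a; rs lists the roots of Q. *)
Definition almost_killed (lam : K) d a := exists2 rs : seq K, lam \notin rs &
  eventually0 (dops (rs ++ nseq d lam) a).

(** The two polynomials Q are multiplied, by concatenating their lists of roots; [lam] is still not
    a root. *)
Lemma almost_killed_lincomb lam d c a b :
  almost_killed lam d a -> almost_killed lam d b ->
  almost_killed lam d (fun k => c *: a k + b k).
Proof.
move=> [rs lr ha] [ss ls hb]; exists (rs ++ ss).
  by rewrite mem_cat negb_or lr.
have [N hN] : eventually0 (fun k => c *: dops (ss ++ rs ++ nseq d lam) a k
                                  + dops (rs ++ ss ++ nseq d lam) b k).
  by apply: eventually0D; rewrite dops_cat; exact: eventually0_dops.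
exists N => k Nk; rewrite dops_lincomb -(hN k Nk) -catA; congr (_ *: _ + _).
by rewrite !catA !(dops_cat (_ ++ _)); exact: dops_catC.
Qed.

Lemma eq_almost_killed lam d a b :
  a =1 b -> almost_killed lam d a -> almost_killed lam d b.
Proof.
move=> ab [rs lr [N ha]]; exists rs => //; exists N => k Nk.
by rewrite -(eq_dops _ ab) ha.
Qed.

Lemma almost_killedD lam d a b :
  almost_killed lam d a -> almost_killed lam d b ->
  almost_killed lam d (fun k => a k + b k).
Proof.
move=> ha hb; apply: eq_almost_killed (almost_killed_lincomb 1 ha hb) => k.
by rewrite scale1r.
Qed.

Lemma eventually0_almost_killed lam d a : eventually0 a -> almost_killed lam d a.
Proof. by move=> ha; exists [::] => //; exact: eventually0_dops. Qed.

Lemma dops_nseq rho d a : dops (nseq d rho) a = iter d (dop rho) a.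
Proof. by elim: d => //= d ->. Qed.

(** Take Q = 1 when rho = lam, and Q(S) = (S - rho)^e otherwise. *)
Lemma killed_almost_killed lam rho d e a :
  (rho = lam -> (e <= d)%N) -> killed rho e a -> almost_killed lam d a.
Proof.
move=> le_ed ha; have [rl|rl] := eqVneq rho lam.
  exists [::] => //; exists 0 => k _; rewrite dops_nseq.
  by rewrite -rl (killed_leq (le_ed rl) ha).
exists (nseq e rho); first by rewrite mem_nseq negb_and (eq_sym lam) rl orbT.
exists 0 => k _; rewrite dops_catC dops_cat [dops (nseq e _) _]dops_nseq.
by rewrite (eq_dops _ (b := fun=> 0)) // dops_nseq; exact: killed0.
Qed.

Lemma almost_killed_leq lam d e a : (d <= e)%N ->
  almost_killed lam d a -> almost_killed lam e a.
Proof.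
move=> /subnK <- [rs lr ha]; exists rs => //.
have [N hN] := eventually0_dops (nseq (e - d) lam) ha.
exists N => k Nk; rewrite nseqD -(hN k Nk) -dops_cat !catA.
by rewrite !(dops_cat (_ ++ _)); exact: dops_catC.
Qed.

Lemma dops_geom (lam : K) rs x k : lam != 0 ->
  dops rs (fun j => lam ^ j *: x) k = (\prod_(r <- rs) (lam - r) * lam ^ k) *: x.
Proof.
move=> l0; elim: rs k => [|r rs IHrs] k; first by rewrite big_nil mul1r.
rewrite /= /dop !IHrs big_cons scalerA -scalerBl expfzDr // expr1z.
by congr (_ *: _); ring.
Qed.

(** On a geometric sequence of ratio lam, Q(S) acts as the nonzero scalar Q(lam), so the result can
    vanish eventually only if x = 0. *)
Lemma almost_killed_geom lam d a x : lam != 0 ->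
  iter d (dop lam) a =1 (fun j => lam ^ j *: x) -> almost_killed lam d a -> x = 0.
Proof.
move=> l0 ax [rs lr [N /(_ N (lexx _))]].
rewrite dops_cat dops_nseq (eq_dops rs ax) dops_geom //.
move/eqP; rewrite scaler_eq0 => /orP[|/eqP //]; rewrite mulf_eq0.
rewrite (negPf (expfz_neq0 N l0)) orbF prodf_seq_eq0 => /hasP[r rr /=].
by rewrite subr_eq0 => /eqP lamr; rewrite lamr rr in lr.
Qed.

End EventuallyKilled.

Lemma linear_dops (K : numFieldType) (U V : lmodType K) (f : U -> V) rs a :
  linear f -> dops rs (fun k => f (a k)) =1 fun k => f (dops rs a k).
Proof.
move=> lf; elim: rs => //= r rs IHrs k; rewrite (eq_dop _ IHrs).
by rewrite /dop (linfB lf) (linfZ lf).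
Qed.

Lemma linear_almost_killed (K : numFieldType) (U V : lmodType K) (f : U -> V)
  lam d a : linear f -> almost_killed lam d a -> almost_killed lam d (fun k => f (a k)).
Proof.
move=> lf [rs lr [N ha]]; exists rs => //; exists N => k Nk.
by rewrite linear_dops // ha // linf0.
Qed.

Lemma almost_killed_inj (K : numFieldType) (U V : lmodType K) (f : U -> V)
  lam d a : linear f -> injective f ->
  almost_killed lam d (fun k => f (a k)) -> almost_killed lam d a.
Proof.
move=> lf fI [rs lr [N ha]]; exists rs => //; exists N => k Nk.
by apply: fI; rewrite (linf0 lf) -(ha k Nk) (linear_dops _ _ lf).
Qed.

(** * Local finiteness *)

Section Span.
Variables (K : fieldType) (V : lmodType K).
Implicit Types (s t : seq V) (u v : V) (F : nat -> V) (p q : {poly K}).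

Lemma in_span_ind s (P : V -> Prop) : P 0 ->
  (forall a u v, P u -> P v -> P (a *: u + v)) ->
  (forall u, u \in s -> P u) -> forall v, in_span s v -> P v.
Proof.
move=> P0 PD Ps v [c ->]; apply: big_rec => // i x _ Px.
by apply: PD => //; apply: Ps; rewrite mem_nth.
Qed.

Lemma in_span0 s : in_span s 0.
Proof. by exists (fun=> 0); rewrite big1 // => i _; rewrite scale0r. Qed.

Lemma in_spanP s a u v : in_span s u -> in_span s v -> in_span s (a *: u + v).
Proof.
move=> [c ->] [d ->]; exists (fun i => a * c i + d i).
rewrite scaler_sumr -big_split; apply: eq_bigr => i _ /=.
by rewrite scalerDl scalerA.
Qed.

Lemma in_spanD s u v : in_span s u -> in_span s v -> in_span s (u + v).
Proof. by move=> hu hv; rewrite -[u]scale1r; exact: in_spanP. Qed.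

Lemma in_spanZ s a u : in_span s u -> in_span s (a *: u).
Proof. by move=> hu; rewrite -[_ *: _]addr0; apply: in_spanP => //; exact: in_span0. Qed.

Lemma mem_in_span s u : u \in s -> in_span s u.
Proof.
move=> us; have lt : (index u s < size s)%N by rewrite index_mem.
exists (fun i => (i == Ordinal lt)%:R); rewrite (bigD1 (Ordinal lt)) //=.
rewrite eqxx scale1r nth_index // big1 ?addr0 // => i /negPf ->.
by rewrite scale0r.
Qed.

Lemma in_span_sub s t v : {subset s <= t} -> in_span s v -> in_span t v.
Proof.
move=> st; apply: (@in_span_ind s (in_span t)); [exact: in_span0 | exact: in_spanP |].
by move=> u /st; exact: mem_in_span.
Qed.

End Span.

Lemma in_span_map (K : fieldType) (V W : lmodType K) (f : V -> W) s v :
  linear f -> in_span s v -> in_span (map f s) (f v).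
Proof.
move=> lf.
apply: (@in_span_ind _ _ s (fun v => in_span (map f s) (f v)))
  => [|a x y hx hy|u us].
- by rewrite (linf0 lf); exact: in_span0.
- by rewrite lf; exact: in_spanP.
- by apply: mem_in_span; exact: map_f.
Qed.

Lemma in_span_eq0 (K : fieldType) (V W : lmodType K) (f : V -> W) s v :
  linear f -> (forall u, u \in s -> f u = 0) -> in_span s v -> f v = 0.
Proof.
move=> lf fs; apply: (@in_span_ind _ _ s (fun v => f v = 0)) => //; first exact: linf0.
by move=> a x y fx fy; rewrite lf fx fy scaler0 addr0.
Qed.

(** * Linear relations and eigenvectors *)

Section PolynomialRelations.
Variables (K : fieldType) (V : lmodType K).
Implicit Types (s t : seq V) (u v : V) (F : nat -> V) (p q : {poly K}).

(** The image of p under the linear map X^i |-> F i, so that a linear relation among the F i is a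
    polynomial sent to 0. *)
Definition psum p F : V := \sum_(i < size p) p`_i *: F i.

Lemma psumEw p F N : (size p <= N)%N -> psum p F = \sum_(i < N) p`_i *: F i.
Proof.
move=> pN; rewrite /psum (big_ord_widen N (fun i => p`_i *: F i)) //.
rewrite big_mkcond; apply: eq_bigr => i _; case: ifPn => //.
by rewrite -leqNgt => /(nth_default 0) ->; rewrite scale0r.
Qed.

Lemma psum_linear p q F a : psum (a *: p + q) F = a *: psum p F + psum q F.
Proof.
pose N := maxn (size (a *: p + q)) (maxn (size p) (size q)).
rewrite !(@psumEw _ F N) /N ?leq_max ?leqnn ?orbT //.
rewrite scaler_sumr -big_split; apply: eq_bigr => i _ /=.
by rewrite coefD coefZ scalerDl scalerA.
Qed.

Lemma psumMX p F : psum ('X * p) F = psum p (fun i => F i.+1).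
Proof.
rewrite (@psumEw _ F (size p).+1); last first.
  by apply: leq_trans (size_polyMleq _ _) _; rewrite size_polyX.
rewrite big_ord_recl coefXM /= scale0r add0r.
by apply: eq_bigr => i _; rewrite coefXM.
Qed.

Lemma span_matrix s F : (forall i, in_span s (F i)) ->
  forall D, exists B : 'M[K]_(D, size s), forall x : 'rV_D, x *m B = 0 ->
    \sum_(i < D) x 0 i *: F i = 0.
Proof.
move=> /choice[c hc] D; exists (\matrix_(i, j) c i j) => x x0.
transitivity (\sum_(j < size s) (\sum_(i < D) x 0 i * c i j) *: s`_j).
  under [RHS]eq_bigr => j _ do rewrite scaler_suml.
  rewrite exchange_big /=; apply: eq_bigr => i _.
  rewrite hc scaler_sumr; apply: eq_bigr => j _; by rewrite scalerA.
rewrite big1 // => j _; have /matrixP/(_ 0 j) := x0.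
rewrite !mxE => e; suff -> : \sum_(i < D) x 0 i * c i j = 0 by rewrite scale0r.
by rewrite -[RHS]e; apply: eq_bigr => i _; rewrite mxE.
Qed.

(** The number n of linear conditions is fixed before the number D of unknowns; D = n + 1 will then
    leave a nonzero solution. *)
Lemma span_matrices (T : eqType) (A : seq T) (F : T -> nat -> V) :
  (forall a, a \in A -> exists s, forall i, in_span s (F a i)) ->
  exists n, forall D, exists B : 'M[K]_(D, n), forall x : 'rV_D, x *m B = 0 ->
    forall a, a \in A -> \sum_(i < D) x 0 i *: F a i = 0.
Proof.
elim: A => [|a A IHA] hA; first by exists 0%N => D; exists 0.
have [s hs] := hA a (mem_head _ _).
have [|n hn] := IHA; first by move=> b bA; apply: hA; rewrite inE bA orbT.
exists (size s + n)%N => D; have [B hB] := span_matrix hs D.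
have [C hC] := hn D; exists (row_mx B C) => x; rewrite mul_mx_row => e.
have [xB xC] : x *m B = 0 /\ x *m C = 0 by apply/eq_row_mx; rewrite e row_mx0.
by move=> b; rewrite inE => /orP[/eqP ->|]; [exact: hB | exact: hC].
Qed.

Lemma common_relation (T : eqType) (A : seq T) (F : T -> nat -> V) :
  (forall a, a \in A -> exists s, forall i, in_span s (F a i)) ->
  exists2 p : {poly K}, p != 0 & forall a, a \in A -> psum p (F a) = 0.
Proof.
move=> /span_matrices[n /(_ n.+1)[B hB]].
have : kermx B != 0.
  rewrite kermx_eq0 -row_leq_rank -ltnNge ltnS; exact: rank_leq_col.
move=> /rowV0Pn[x /sub_kermxP xB x0]; exists (rVpoly x).
  by apply: contraNneq x0 => /(canRL rVpolyK) ->; rewrite linear0.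
move=> a aA; rewrite (@psumEw _ _ n.+1) ?size_poly // -[RHS](hB x xB a aA).
by apply: eq_bigr => i _; rewrite coef_rVpoly_ord.
Qed.

End PolynomialRelations.

Section Eigenvector.
Variables (K : numClosedFieldType) (V : lmodType K) (T : V -> V).
Hypothesis lT : linear T.

Lemma psum_iter_mulXsubC (p : {poly K}) r v :
  psum (('X - r%:P) * p) (fun i => iter i T v) =
  T (psum p (fun i => iter i T v)) - r *: psum p (fun i => iter i T v).
Proof.
rewrite mulrBl mul_polyC addrC -scaleNr psum_linear scaleNr addrC; congr (_ - _).
rewrite psumMX /psum (linf_sum lT); apply: eq_bigr => i _.
by rewrite (linfZ lT).
Qed.

(** Some nonzero p has p(T) v = 0. Removing its linear factors one at a time, one meets q and r with
    q(T) v != 0 and (T - r) q(T) v = 0, since the empty product leaves v itself. *)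
Lemma locally_finite_eigenvector (v : V) : locally_finite T -> v != 0 ->
  exists (u : V) (c : K), u != 0 /\ T u = c *: u.
Proof.
move=> /(_ v)[s [sv Ts]] v0.
have [|p p0 /(_ tt (mem_head _ [::]))] :=
    @common_relation K V unit [:: tt] (fun _ i => iter i T v).
  by move=> _ _; exists s; elim=> //= i; exact: Ts.
have [rs ->] := closed_field_poly_normal p.
rewrite -[_ *: _]addr0 psum_linear [psum 0 _]/psum size_poly0 big_ord0 addr0.
move/eqP; rewrite scaler_eq0 lead_coef_eq0 (negPf p0) /=.
elim: rs => [|r rs IHrs].
  rewrite big_nil (@psumEw _ _ _ _ 1) ?size_poly1 // big_ord1 coef1 scale1r.
  by rewrite (negPf v0).
rewrite big_cons psum_iter_mulXsubC.
set u := psum _ _ in IHrs *; have [u0 _|u0] := eqVneq u 0.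
  by apply: IHrs; rewrite u0.
by rewrite subr_eq0 => /eqP Tu; exists u, r.
Qed.

End Eigenvector.

(** * Irreducible Virasoro modules that are locally finite over a positive part *)

Section VirasoroModules.
Variables (K : numFieldType) (V : lieModule (virasoro K)).
Implicit Types (u v : V) (m n k : int).

Local Notation L := (@Lop K V).
Local Notation C := (@act K (virasoro K) V VirC).

Lemma Lop_linear m : linear (L m).
Proof. exact: act_linear. Qed.

Lemma Lop_br m n v : L m (L n v) - L n (L m v) = (n - m)%:~R *: L (m + n) v +
  (if m + n == 0 then (m%:~R ^+ 3 - m%:~R) / 12%:R else 0) *: C v.
Proof.
rewrite -act_br /= linearD !linearZ /= !lextU //.
Qed.

Lemma Lop_comm m n v : m + n != 0 ->
  L m (L n v) = L n (L m v) + (n - m)%:~R *: L (m + n) v.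
Proof.
move=> mn; have := Lop_br m n v; rewrite (negPf mn) scale0r addr0 => <-.
by rewrite addrCA subrr addr0.
Qed.

Lemma Lop_C m v : L m (C v) = C (L m v).
Proof.
apply/eqP; rewrite -subr_eq0 -(@act_br K (virasoro K) V (VirL m) VirC v) /=.
by rewrite raddf0.
Qed.

Lemma irreducible_ind (P : V -> Prop) : irreducible V ->
  P 0 -> (forall a u v, P u -> P v -> P (a *: u + v)) ->
  (forall m v, P v -> P (L m v)) -> (forall v, P v -> P (C v)) ->
  forall u, u != 0 -> P u -> forall v, P v.
Proof.
move=> [_ irr] P0 PD PL PC u u0 Pu v.
case: (irr [pred x | `[< P x >]]).
- split.
    split; first exact/asboolP.
    by move=> a x y /asboolP Px /asboolP Py; apply/asboolP; exact: PD.
  by case=> [m|] x /asboolP Px; apply/asboolP; [exact: PL | exact: PC].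
- by move=> /(_ u)/(_ (introT (asboolP _) Pu)) ue; rewrite ue eqxx in u0.
- by move=> /(_ v)/asboolP.
Qed.

(** The L_k v with k large lie in one finite-dimensional space. The tame vectors form a submodule,
    so in an irreducible module one nonzero tame vector is enough. *)
Definition tame v := exists s N, forall k, N <= k -> in_span s (L k v).

Lemma tame0 : tame 0.
Proof.
exists [::], 0 => k _; rewrite (linf0 (Lop_linear k)); exact: in_span0.
Qed.

Lemma tameP a u v : tame u -> tame v -> tame (a *: u + v).
Proof.
move=> [s [M hs]] [t [N ht]]; exists (s ++ t), (Num.max M N) => k.
rewrite ge_max => /andP[Mk Nk]; rewrite Lop_linear; apply: in_spanP.
  by apply: in_span_sub (hs k Mk) => x xs; rewrite mem_cat xs.
by apply: in_span_sub (ht k Nk) => x xs; rewrite mem_cat xs orbT.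
Qed.

Lemma tame_L m v : tame v -> tame (L m v).
Proof.
move=> [s [N hs]]; exists (map (L m) s ++ s), (Num.max (N + `|m|) (`|m| + 1)).
move=> k; rewrite ge_max => /andP[Nk mk].
rewrite Lop_comm; last by lia.
apply: in_spanD; last apply: in_spanZ.
  apply: in_span_sub (in_span_map (Lop_linear m) (hs k _)); last by lia.
  by move=> x xs; rewrite mem_cat xs.
apply: in_span_sub (hs (k + m) _); last by lia.
by move=> x xs; rewrite mem_cat xs orbT.
Qed.

Lemma tame_C v : tame v -> tame (C v).
Proof.
move=> [s [N hs]]; exists (map C s), N => k Nk; rewrite Lop_C.
apply: in_span_map (hs k Nk); exact: act_linear.
Qed.

(** L_m - c sends L_j v to (j - m) L_(j+m) v, and along the iteration these coefficients stay
    nonzero because j > m. *)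
Lemma iter_Lop_eigen m c v j i : L m v = c *: v -> 0 < m -> m < j ->
  exists2 a, a != 0 &
  iter i (fun u => L m u - c *: u) (L j v) = a *: L (j + i%:Z * m) v.
Proof.
move=> ev m0 mj; elim: i => [|i [a a0 IHi]].
  by exists 1; rewrite ?oner_eq0 // mul0r addr0 scale1r.
exists (a * (j + i%:Z * m - m)%:~R).
  by rewrite mulf_neq0 // intr_eq0; nia.
rewrite iterS IHi (linfZ (Lop_linear m)) Lop_comm; last by nia.
rewrite ev (linfZ (Lop_linear _)) scalerDr !scalerA [a * c]mulrC addrAC subrr.
by rewrite add0r; congr (_ *: L _ v); lia.
Qed.

(** Up to a scalar, every L_k v with k > m arises by iterating L_m - c on one of L_(m+1) v, ...,
    L_(2m) v, and each of these lies in a finite-dimensional L_m-invariant space. *)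
Lemma eigenvector_tame m c v : locally_finite (L m) -> L m v = c *: v -> 0 < m ->
  tame v.
Proof.
move=> lf ev m0.
have /choice[s hs] j : exists s : seq V, in_span s (L j v) /\
    forall u, in_span s u -> in_span s (L m u) by exact: lf.
exists (flatten [seq s (m + 1 + j%:Z) | j <- iota 0 `|m|%N]), (m + 1) => k mk.
pose q : int := k - m - 1.
pose i := (`|q| %/ `|m|)%N; pose j := (`|q| %% `|m|)%N.
have mpos : (0 < `|m|)%N by lia.
have eqk : k = m + 1 + j%:Z + i%:Z * m.
  have := divn_eq `|q| `|m|; rewrite -/i -/j /q; nia.
have [||a a0 e] := @iter_Lop_eigen m c v (m + 1 + j%:Z) i ev; [by []|by lia|].
rewrite -[L k v](scalerK a0) eqk -e; apply: in_spanZ.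
have [s1 s2] := hs (m + 1 + j%:Z).
apply: (@in_span_sub _ _ (s (m + 1 + j%:Z))).
  move=> x xs; apply/flattenP; exists (s (m + 1 + j%:Z)) => //.
  by apply/mapP; exists j => //; rewrite mem_iota add0n ltn_mod.
elim: (i) => //= i' IHi; set x := iter i' _ _ in IHi *.
by rewrite -scaleNr [L m x + _]addrC; apply: in_spanP => //; exact: s2.
Qed.

(** p is the characteristic polynomial of a linear recurrence that k |-> L_k v satisfies for k
    large. *)
Definition is_relation v (p : {poly K}) :=
  exists M, forall m, M <= m -> psum p (fun i => L (m + i%:Z) v) = 0.

Lemma psumD (p : {poly K}) (F G : nat -> V) :
  psum p (fun i => F i + G i) = psum p F + psum p G.
Proof. by rewrite -big_split; apply: eq_bigr => i _; rewrite scalerDr. Qed.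

Lemma psumZ (p : {poly K}) a (F : nat -> V) :
  psum p (fun i => a *: F i) = a *: psum p F.
Proof.
rewrite scaler_sumr; apply: eq_bigr => i _; by rewrite !scalerA mulrC.
Qed.

Lemma psum_deriv (p : {poly K}) (F : nat -> V) :
  psum p^`() (fun i => F i.+1) = psum p (fun i => i%:R *: F i).
Proof.
rewrite -psumMX.
rewrite (@psumEw _ _ _ _ (size p).+1); last first.
  apply: leq_trans (size_polyMleq _ _) _; rewrite size_polyX.
  have [->|/lt_size_deriv/leqW //] := eqVneq p 0.
  by rewrite deriv0 size_poly0.
rewrite [RHS](@psumEw _ _ _ _ (size p).+1) //.
apply: eq_bigr => i _; rewrite coefXM coef_deriv scalerA.
by case: (i : nat) => [|j] /=; rewrite ?mulr0 ?scale0r // mulr_natr.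
Qed.
(** Applying L_m - c to the relation at k multiplies its i-th term by k + i - m and moves it to k +
    m. Subtracting k - m times the relation at k + m leaves the weights i, which are those of the
    derivative. *)
Lemma relation_deriv m c v p : L m v = c *: v ->
  is_relation v p -> is_relation v p^`().
Proof.
move=> ev [M hM]; exists (Num.max M (`|m| + 1) + `|m| + 1) => k' hk'.
(* The extra 1 compensates the loss of one in the exponents under derivation. *)
pose k := k' - m - 1.
have [Mk mk Mkm] : [/\ M <= k, `|m| < k & M <= k + m] by rewrite /k; split; lia.
transitivity (psum p^`() (fun i => L (k + m + i.+1%:Z) v)).
  by apply: eq_bigr => i _; congr (_ *: L _ v); rewrite /k; lia.
rewrite (psum_deriv p (fun i => L (k + m + i%:Z) v)).
transitivity (L m (psum p (fun i => L (k + i%:Z) v))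
  - c *: psum p (fun i => L (k + i%:Z) v)
  - (k - m)%:~R *: psum p (fun i => L (k + m + i%:Z) v)); last first.
  by rewrite !hM // (linf0 (Lop_linear m)) !scaler0 !subr0.
rewrite -scaleNr -scaleNr -!psumZ /psum (linf_sum (Lop_linear m)) -!big_split.
apply: eq_bigr => i _ /=; rewrite (linfZ (Lop_linear m)) -!scalerDr; congr (_ *: _).
rewrite Lop_comm; last by lia.
rewrite ev (linfZ (Lop_linear _)) !scaleNr [c *: _ + _]addrC addrK.
have -> : m + (k + i%:Z) = k + m + i%:Z by lia.
rewrite -scalerBl; congr (_ *: _); ring.
Qed.

(* On an eigenvector, relations are closed under differentiation, down to a
   nonzero constant. *)
Lemma relation_eventually0 m c v (p : {poly K}) : L m v = c *: v -> p != 0 ->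
  is_relation v p -> eventually0 (fun k => L k v).
Proof.
move=> ev; have [d] := ubnP (size p); elim: d p => // d IHd p.
rewrite ltnS => pd p0 rp; have [sp|sp] := leqP (size p) 1.
  have /size_poly1P[b b0 pb] : size p == 1%N.
    by rewrite eqn_leq sp lt0n size_poly_eq0.
  have [N hN] := rp; exists N => k /hN.
  rewrite pb (@psumEw _ _ _ _ 1) ?size_polyC_leq1 // big_ord1 coefC /= addr0.
  by move/eqP; rewrite scaler_eq0 (negPf b0) /= => /eqP.
apply: (IHd p^`()); last exact: relation_deriv ev rp.
  apply: leq_trans pd; exact: lt_size_deriv.
apply/eqP => /polyP/(_ (size p).-2); rewrite coef_deriv coef0.
move/eqP; rewrite mulrn_eq0 /=.
have -> : (size p).-2.+1 = (size p).-1 by lia.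
by rewrite -/(lead_coef p) lead_coef_eq0 (negPf p0); lia.
Qed.

Lemma common_bound (T : eqType) (A : seq T) (f : T -> int) :
  exists N : int, 0 < N /\ forall a, a \in A -> f a <= N.
Proof.
elim: A => [|a A [N [N0 hN]]]; first by exists 1.
exists (Num.max N (f a)); split; first by lia.
by move=> b; rewrite inE => /orP[/eqP ->|/hN]; lia.
Qed.

(* Some nonzero x in the span of the L_i, i >= N, annihilates v, all the L_q v
   and all the L_q L_r v, so that [L_r, [L_q, x]] v = 0 whenever q, r >= N.  A
   second difference in q, at fixed q + r, turns this into a relation with
   constant coefficients. *)
Lemma tame_relation v : (forall u, tame u) ->
  exists2 p : {poly K}, p != 0 & is_relation v p.
Proof.
move=> /choice[S] /choice[B hS].
pose A := v :: S v ++ flatten (map S (S v)).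
have [N [N0 hN]] := common_bound A B.
have [|p p0 Xp] := @common_relation K V V A (fun u i => L (N + i%:Z) u).
  by move=> a aA; exists (S a) => i; apply: hS; have := hN a aA; lia.
exists p => //.
pose X u := psum p (fun i => L (N + i%:Z) u).
pose ad (q : int) u := psum p
  (fun i => (N + i%:Z - q)%:~R *: L (q + (N + i%:Z)) u).
have lX : linear X.
  move=> a x y; rewrite /X -psumZ -psumD; apply: eq_bigr => i _.
  by rewrite Lop_linear.
have XA u : u \in A -> X u = 0 by exact: Xp.
have S_A u : u \in S v -> u \in A.
  by move=> us; rewrite /A inE mem_cat us orbT.
(* [ad q] is the commutator [L_q, X]; as q and N are positive, no central term occurs. *)
have adE q u : 0 < q -> ad q u = L q (X u) - X (L q u).
  move=> q0; rewrite /ad /X /psum (linf_sum (Lop_linear q)) -sumrB.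
  apply: eq_bigr => i _; rewrite (linfZ (Lop_linear q)) -scalerBr.
  rewrite Lop_comm; last by lia.
  by rewrite [L _ (L q u) + _]addrC addrK.
have XLv q : N <= q -> X (L q v) = 0.
  move=> Nq; have := hS v q; rewrite (le_trans (hN v (mem_head _ _)) Nq).
  by move=> /(_ isT); apply: in_span_eq0 => // u /S_A; exact: XA.
have XLLv q r : N <= q -> N <= r -> X (L q (L r v)) = 0.
  move=> Nq Nr; have := hS v r; rewrite (le_trans (hN v (mem_head _ _)) Nr).
  move=> /(_ isT); apply: (in_span_eq0 (f := fun u => X (L q u))) => [|u us].
    exact: lin_comp lX (Lop_linear q).
  have := hS u q; rewrite (le_trans (hN u (S_A u us)) Nq) => /(_ isT).
  apply: in_span_eq0 => // w ws; apply: XA; rewrite /A inE mem_cat.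
  by apply/orP; right; apply/orP; right; apply/flattenP; exists (S u); rewrite ?map_f.
have adv q : N <= q -> ad q v = 0.
  move=> Nq; rewrite adE ?XLv // ?XA ?mem_head //; last by lia.
  by rewrite (linf0 (Lop_linear q)) subrr.
have adLv q r : N <= q -> N <= r -> ad q (L r v) = 0.
  move=> Nq Nr; rewrite adE ?XLv // ?XLLv //; last by lia.
  by rewrite (linf0 (Lop_linear q)) subrr.
have ad2 q r : N <= q -> N <= r -> psum p (fun i =>
   ((N + i%:Z - q)%:~R * (N + i%:Z + q - r)%:~R) *: L (q + r + (N + i%:Z)) v) = 0.
  move=> Nq Nr; transitivity (L r (ad q v) - ad q (L r v)); last first.
    by rewrite adv // adLv // (linf0 (Lop_linear r)) subrr.
  rewrite /ad /psum (linf_sum (Lop_linear r)) -sumrB; apply: eq_bigr => i _.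
  rewrite (linfZ (Lop_linear r)) -scalerBr; congr (_ *: _).
  rewrite (linfZ (Lop_linear r)) -scalerBr -scalerA; congr (_ *: _).
  rewrite (@Lop_comm r); last by lia.
  rewrite [L _ (L r v) + _]addrC addrK; congr (_%:~R *: L _ v); lia.
(* This bound gives m - q >= N for each of q = N, N + 1, N + 2. *)
exists (3%:Z * N + 2) => k hk.
pose m := k - N.
pose f (q : int) := psum p (fun i =>
   ((N + i%:Z - q)%:~R * (N + i%:Z + q - (m - q))%:~R) *: L (k + i%:Z) v).
have f0 q : N <= q -> q <= N + 2 -> f q = 0.
  move=> Nq qN; rewrite -[RHS](ad2 q (m - q)) //; last by rewrite /m; lia.
  apply: eq_bigr => i _; congr (_ *: (_ *: L _ v)); rewrite /m; lia.
(* The weights in [f] are quadratic in q with leading coefficient -2, so their second difference is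
   the constant -4. *)
have : f N + (-2) *: f (N + 1) + f (N + 2) = 0.
  by rewrite !f0 ?scaler0 ?addr0 //; lia.
rewrite -psumZ -!psumD => e.
have : (-4) *: psum p (fun i => L (k + i%:Z) v) = 0.
  rewrite -psumZ -[RHS]e; apply: eq_bigr => i _; congr (_ *: _).
  rewrite scalerA -!scalerDl; congr (_ *: _); rewrite /m; ring.
by move/eqP; rewrite scaler_eq0 oppr_eq0 pnatr_eq0 /= => /eqP.
Qed.

End VirasoroModules.

(* Mazorchuk and Zhao, Simple Virasoro modules which are locally finite over a
   positive part. *)
Lemma irreducible_eventually0 (K : numClosedFieldType)
    (V : lieModule (virasoro K)) : irreducible V -> eventually_locally_finite V ->
  forall v : V, eventually0 (fun k => Lop k v).
Proof.
move=> irr [R lf]; have [[v0 v00] _] := irr.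
(* R + 1 rather than R, because [eigenvector_tame] asks for a positive index. *)
have lfR : locally_finite (@Lop K V R.+1%:Z) by apply: lf; lia.
have [u [c [u0 ev]]] :=
  locally_finite_eigenvector (@Lop_linear K V R.+1%:Z) lfR v00.
have all_tame (v : V) : tame v.
  move: v; refine (irreducible_ind (P := @tame K V) irr _ _ _ _ u0 _).
  - exact: tame0.
  - exact: tameP.
  - exact: tame_L.
  - exact: tame_C.
  - exact: eigenvector_tame lfR ev _.
have [p p0 rp] := tame_relation u all_tame.
refine (irreducible_ind (P := fun v => eventually0 (fun k => Lop k v)) irr _ _ _ _ u0 _).
- by exists 0 => k _; exact: linf0 (@Lop_linear K V k).
- move=> a x y hx hy; have [N hN] := eventually0D a hx hy.
  by exists N => k Nk; rewrite Lop_linear hN.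
- move=> m v [N hN]; exists (Num.max (N + `|m|) (`|m| + 1)) => k hk.
  rewrite Lop_comm; last by lia.
  rewrite !hN ?scaler0 ?addr0; [exact: linf0 (@Lop_linear K V m)|lia|lia].
- move=> v [N hN]; exists N => k Nk; rewrite Lop_C hN //.
  exact: linf0 (@act_linear _ (virasoro K) V VirC).
- exact: relation_eventually0 ev p0 rp.
Qed.

(** * Coordinates on Phi (x) U *)

(** The two top terms of p(X - c), for J bounding the degree of p: (X - c)^J begins with X^J - J c
    X^(J-1). *)
Lemma comp_XsubC_top (R : idomainType) (p : {poly R}) (c : R) J :
  (size p <= J.+1)%N ->
  (p \Po ('X - c%:P))`_J = p`_J /\
  ((0 < J)%N -> (p \Po ('X - c%:P))`_J.-1 = p`_J.-1 - J%:R * c * p`_J).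
Proof.
elim/poly_ind: p J => [|p a IHp] J.
  by rewrite comp_poly0 !coef0 mulr0 subr0.
rewrite size_MXaddC comp_poly_MXaddC => sp.
have {}sp : (size p <= J)%N.
  by move: sp; case: ifP => // /andP[/eqP -> _]; rewrite size_poly0.
have s0 : size (p \Po ('X - c%:P)) = size p.
  by rewrite size_comp_poly2 // size_XsubC.
have cM q k : (q * ('X - c%:P) + a%:P)`_k =
    (if (k == 0)%N then a else q`_k.-1) - c * q`_k.
  rewrite coefD mulrBr coefB coefMX coefMC coefC mulrC.
  by case: (k == 0)%N; rewrite ?addr0 ?sub0r // addrC.
have cX k : (p * 'X + a%:P)`_k = if (k == 0)%N then a else p`_k.-1.
  by rewrite coefD coefMX coefC; case: (k == 0)%N; rewrite ?add0r ?addr0.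
rewrite !cM !cX; case: J sp => [|J] sp /=.
  by split=> //; rewrite [_`_0](nth_default 0) ?s0 // mulr0 subr0.
have [e1 e2] := IHp J sp; rewrite e1; split=> [|_].
  by rewrite [_`_J.+1](nth_default 0) ?s0 // mulr0 subr0.
case: J sp e1 e2 => [|J] sp e1 e2 /=; first by rewrite mul1r.
rewrite e2 // -natr1; ring.
Qed.

Section PhiTensor.
Variables (K : numFieldType) (lambda alpha : nonzero K) (h : {poly K}).
Variables (U : lieModule (virasoro K)).

Local Notation lam := (val lambda).
Local Notation alp := (val alpha).
Local Notation Phi := (Phi lambda alpha h).
Local Notation W := (tensor_module Phi U).
Local Notation L := (@Lop K _).

Lemma Lop_tens (X Y : lieModule (virasoro K)) m (x : X) (y : Y) :
  @Lop K (tensor_module X Y) m (tens x y) = tens (Lop m x) y + tens x (Lop m y).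
Proof. exact: tensor_actE. Qed.

(** The monomial t^i s^j; in [phi_coord] too, the first index is the exponent of t and the second
    that of s. *)
Definition bimon i j : bipoly K := (('X^j)%:P * 'X^i : {poly {poly K}}).

Lemma bicoef_linear i j :
  linear (fun f : bipoly K => ((f : {poly {poly K}})`_i`_j : K^o)).
Proof. by move=> a f g; rewrite !coefD !coefCM. Qed.

Lemma bimon_coef i j i' j' :
  ((bimon i j : {poly {poly K}})`_i')`_j' = (i' == i)%:R * (j' == j)%:R.
Proof.
rewrite coefCM coefXn; case: (i' == i); rewrite ?mulr1 ?mulr0 ?mul1r ?mul0r ?coef0 //.
exact: coefXn.
Qed.

Lemma bicoef_scale_linear i j (u : U) :
  linear (fun f : bipoly K => (f : {poly {poly K}})`_i`_j *: u).
Proof. by move=> a f g; rewrite bicoef_linear scalerDl scalerA. Qed.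

Lemma scale_linear (a : K) : linear (fun u : U => a *: u).
Proof. by move=> b u v; rewrite scalerDr !scalerA mulrC. Qed.

Definition phi_coord i j : W -> U :=
  tlift (fun (f : bipoly K) u => (f : {poly {poly K}})`_i`_j *: u).

Lemma phi_coord_linear i j : linear (phi_coord i j).
Proof.
exact: (tlift_linear (bicoef_scale_linear i j)
                     (fun f : bipoly K => scale_linear _)).
Qed.

Lemma phi_coordE i j (f : Phi) (u : U) :
  phi_coord i j (tens f u) = (f : {poly {poly K}})`_i`_j *: u.
Proof.
exact: (tliftE (bicoef_scale_linear i j)
               (fun f : bipoly K => scale_linear _)).
Qed.

Lemma bipoly_expand (f : bipoly K) B : (size (f : {poly {poly K}}) <= B)%N ->
  (forall i, (size ((f : {poly {poly K}})`_i)%R <= B)%N) ->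
  f = \sum_(i < B) \sum_(j < B)
    (f : {poly {poly K}})`_i`_j *: (bimon i j : bipoly K).
Proof.
move=> sf sfi; apply/polyP => k; apply/polyP => l.
pose cf (f : bipoly K) : K^o := (f : {poly {poly K}})`_k`_l.
have lc : linear cf by exact: bicoef_linear.
rewrite -[RHS]/(cf _) (linf_sum lc).
under eq_bigr => i _.
  rewrite (linf_sum lc).
  under eq_bigr => j _.
    rewrite (linfZ lc) [cf _]bimon_coef.
    over.
  over.
rewrite /=; have [kB|kB] := ltnP k B; last first.
  rewrite (nth_default _ (leq_trans sf kB)) coef0 big1 // => i _.
  rewrite big1 // => j _; case: eqP => [e|]; last by rewrite mul0r scaler0.
  by have := ltn_ord i; rewrite -e ltnNge kB.
rewrite (bigD1 (Ordinal kB)) //= [X in _ + X]big1 ?addr0; last first.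
  move=> i ne; rewrite big1 // => j _; case: eqP => [e|]; last by rewrite mul0r scaler0.
  by case/eqP: ne; exact: val_inj.
have [lB|lB] := ltnP l B; last first.
  rewrite (nth_default _ (leq_trans (sfi _) lB)) big1 // => j _.
  rewrite eqxx mul1r; case: eqP => [e|]; last by rewrite scaler0.
  by have := ltn_ord j; rewrite -e ltnNge lB.
rewrite (bigD1 (Ordinal lB)) //= !eqxx mul1r [X in _ + X]big1 ?addr0.
  by rewrite [RHS]mulr1.
move=> j ne; rewrite mul1r; case: eqP => [e|]; last by rewrite scaler0.
by case/eqP: ne; exact: val_inj.
Qed.

(** The expansion is stated for all large bounds so that those of two summands can be brought to a
    common one. *)
Lemma phi_coord_expand (w : W) : exists B, forall B', (B <= B')%N ->
  w = \sum_(i < B') \sum_(j < B') tens (bimon i j : Phi) (phi_coord i j w).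
Proof.
elim/tensor_ind: w => [x y [A hA] [B hB]|f u].
  exists (maxn A B) => C; rewrite geq_max => /andP[AC BC].
  rewrite {1}(hA C AC) {1}(hB C BC) -big_split; apply: eq_bigr => i _.
  rewrite -big_split; apply: eq_bigr => j _ /=.
  by rewrite (linfD (phi_coord_linear i j)) (linfD (@tens_linearr _ _ _ _)).
pose fp := (f : {poly {poly K}}).
exists (maxn (size fp) (\max_(i < size fp) size (fp`_i)%R)) => B.
rewrite geq_max => /andP[sf /bigmax_leqP sfi].
have {}sfi i : (size (fp`_i)%R <= B)%N.
  have [lt|le] := ltnP i (size fp); first exact: (sfi (Ordinal lt)).
  by rewrite nth_default // size_poly0.
rewrite {1}[f](bipoly_expand sf sfi).
rewrite (linf_sum (@tens_linearl _ _ _ _)); apply: eq_bigr => i _.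
rewrite (linf_sum (@tens_linearl _ _ _ _)); apply: eq_bigr => j _.
by rewrite phi_coordE (linfZ (@tens_linearl _ _ _ _)) (linfZ (@tens_linearr _ _ _ _)).
Qed.

Lemma phi_coord_bimon i j i' j' u :
  phi_coord i j (tens (bimon i' j' : Phi) u) = ((i == i')%:R * (j == j')%:R) *: u.
Proof. by rewrite phi_coordE bimon_coef. Qed.

Lemma phi_coord_finite w : exists B, forall i j, (B <= i)%N || (B <= j)%N ->
  phi_coord i j w = 0.
Proof.
have [B hB] := phi_coord_expand w; exists B => i j ij.
rewrite (hB B (leqnn _)) (linf_sum (phi_coord_linear i j)) big1 // => i' _.
rewrite (linf_sum (phi_coord_linear i j)) big1 // => j' _; rewrite phi_coord_bimon.
have /nandP[/negPf ->|/negPf ->] : ~~ ((i == i') && (j == j')).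
- apply: contraL ij => /andP[/eqP -> /eqP ->].
  by rewrite negb_or -!ltnNge !ltn_ord.
- by rewrite mul0r scale0r.
- by rewrite mulr0 scale0r.
Qed.

Definition sdeg_le J w := forall i j, (J < j)%N -> phi_coord i j w = 0.

Lemma sdeg_le_expand J w : sdeg_le J w -> exists B,
  w = \sum_(i < B) \sum_(j < J.+1) tens (bimon i j : Phi) (phi_coord i j w).
Proof.
move=> wJ; have [B hB] := phi_coord_expand w; exists (maxn B J.+1).
rewrite {1}(hB _ (leq_maxl B J.+1)); apply: eq_bigr => i _.
rewrite (@big_ord_widen _ _ _ J.+1 (maxn B J.+1)
  (fun j => tens (bimon i j : Phi) (phi_coord i j w))) ?leq_maxr //.
rewrite [RHS]big_mkcond; apply: eq_bigr => j _; case: ifPn => //.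
rewrite -leqNgt => /wJ ->; exact: linf0 (@tens_linearr _ _ _ _).
Qed.

Lemma sdeg_le_bound (s : seq W) : exists J, forall w, w \in s -> sdeg_le J w.
Proof.
elim: s => [|w s [J hJ]]; first by exists 0%N.
have [B hB] := phi_coord_finite w; exists (maxn B J) => x; rewrite inE.
case/orP => [/eqP ->|xs] i j; rewrite gtn_max => /andP[Bj Jj].
  by apply: hB; rewrite (ltnW Bj) orbT.
exact: (hJ x xs i j Jj).
Qed.

(** Leading coordinate: first the largest exponent J of s, then the largest exponent i of t beside
    s^J. *)
Lemma top_phi_coord w : w != 0 -> exists J i, [/\ sdeg_le J w, phi_coord i J w != 0 &
  forall i', (i < i')%N -> phi_coord i' J w = 0].
Proof.
move=> w0; have [B hB] := phi_coord_finite w.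
pose P (j : nat) : bool := `[< exists i, phi_coord i j w != 0 >].
have PP j : reflect (exists i, phi_coord i j w != 0) (P j) by exact: asboolP.
have exP : exists j, P j.
  apply: contrapT => nP; case/eqP: w0; have [A hA] := phi_coord_expand w.
  rewrite (hA A (leqnn _)) big1 // => i _; rewrite big1 // => j _.
  suff -> : phi_coord i j w = 0 by exact: linf0 (@tens_linearr _ _ _ _).
  apply/eqP; apply: contrapT => /negP ij; apply: nP; exists j.
  by apply: (introT (PP j)); exists i.
have PB j : P j -> (j <= B)%N.
  move=> Pj; case: (elimT (PP j) Pj) => i; apply: contraNT; rewrite -ltnNge => /ltnW Bj.
  by rewrite hB // Bj orbT.
have [J PJ Jmax] := ex_maxnP exP PB; have [i0 Q0] := elimT (PP J) PJ.
have QB i : phi_coord i J w != 0 -> (i <= B)%N.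
  by apply: contraNT; rewrite -ltnNge => /ltnW Bi; rewrite hB // Bi.
have exQ : exists i, phi_coord i J w != 0 by exists i0.
have [i iJ imax] := ex_maxnP exQ QB.
exists J, i; split=> // [i' j Jj|i' ii']; apply/eqP.
  apply: contraTT Jj => ij; rewrite -leqNgt; apply: Jmax.
  by apply: (introT (PP j)); exists i'.
by apply: contraTT ii' => ij; rewrite -leqNgt; exact: imax.
Qed.

End PhiTensor.

(** * The action on Phi *)

(** When h has degree 1, the quotient g is constant, equal to the leading coefficient of h. *)
Lemma phi_coefs_linear (K : numFieldType) (alpha : nonzero K) (h : {poly K}) :
  size h = 2%N -> exists g0 h0 : K,
  [/\ g0 != 0, h = g0 *: 'X + h0%:P & phi_g alpha h = g0%:P].
Proof.
move=> sh; pose g := phi_g alpha h.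
have hE : h = g * ('X - (val alpha)%:P) + (h.[val alpha])%:P by exact: phi_gE.
have g0 : g != 0.
  apply/eqP => ge; move: sh; rewrite hE ge mul0r add0r => sh.
  by have := size_polyC_leq1 (h.[val alpha]); rewrite sh.
have sg : size g = 1%N.
  move: sh; rewrite hE size_polyDl ?size_Mmonic ?monicXsubC // size_XsubC.
    by rewrite addn2 /= => -[].
  rewrite addn2 /=; apply: leq_ltn_trans (size_polyC_leq1 _) _.
  by rewrite ltnS lt0n size_poly_eq0.
have /size_poly1P[b b0 gb] : size g == 1%N by rewrite sg.
exists b, (h.[val alpha] - b * val alpha); split=> //.
rewrite {1}hE gb mul_polyC scalerBr polyCB -addrA; congr (_ + _).
by rewrite addrC polyCM mul_polyC.
Qed.

Section PhiLinear.
Variables (K : numFieldType) (lambda alpha : nonzero K) (h : {poly K}).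
Variables (g0 h0 : K).
Hypothesis hE : h = g0 *: 'X + h0%:P.
Hypothesis gE : phi_g alpha h = g0%:P.

Local Notation lam := (val lambda).
Local Notation alp := (val alpha).
Local Notation P := {poly {poly K}}.
Local Notation Phi := (Phi lambda alpha h).

Lemma phi_L_coef (m : int) (f : bipoly K) i :
  let x : K := m%:~R in
  let F := shift_s m (f : P) in
  (phi_L lambda alpha h m f : P)`_i = lam ^ m *:
    ('X * F`_i + (x * h0 - x * (x - 1) * alp * g0 - x * i%:R) *: F`_i
     + (x * g0) *: (if (i == 0)%N then 0 else F`_i.-1)
     + (x ^+ 2 * alp * i.+1%:R) *: F`_i.+1).
Proof.
move=> x F; rewrite /phi_L -/F gE.
have -> : poly_t h = g0%:P%:P * 'X + h0%:P%:P.
  by rewrite /poly_t hE -mul_polyC rmorphD rmorphM /= map_polyX !map_polyC.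
have -> : poly_t g0%:P = g0%:P%:P by rewrite /poly_t map_polyC.
have intE (b : int) : b%:~R = (b%:~R : K)%:P%:P :> P by rewrite !rmorph_int.
rewrite !intE.
have -> : (m * (m - 1))%:~R = x * (x - 1) :> K by rewrite /x !rmorphM rmorphB.
rewrite -/x.
rewrite coefCM -mul_polyC; congr (_ * _).
transitivity (('X%:P * F + (x * h0 - x * (x - 1) * alp * g0)%:P%:P * F
   + (x * g0)%:P%:P * ('X * F) - x%:P%:P * ('X * F^`())
   + (x ^+ 2 * alp)%:P%:P * F^`())`_i).
  apply: (congr1 (fun p : P => p`_i)); rewrite !(polyCM, polyCB, polyCD, polyC_exp); ring.
rewrite !(coefD, coefN, coefCM, coefXM, coef_deriv).
rewrite -!mul_polyC; case: i => [|i] /=.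
  move: F`_0 F`_1 => F0 F1.
  by rewrite !(polyCM, polyCB) polyC1; ring.
move: F`_i F`_i.+1 F`_i.+2 => Fi Fi1 Fi2.
rewrite -[Fi1 *+ _]mulr_natr -[Fi2 *+ _]mulr_natr.
rewrite !(polyCM, polyCB) !polyC_natr; ring.
Qed.

(** Replacing s by s - m keeps the degree in s; only the factor s of the action raises it, by
    one. *)
Lemma phi_L_bound m (f : bipoly K) J :
  (forall i, (size ((f : P)`_i)%R <= J.+1)%N) ->
  forall i j, (J.+1 < j)%N -> (phi_L lambda alpha h m f : P)`_i`_j = 0.
Proof.
move=> fJ i [//|j] Jj; rewrite phi_L_coef.
have sF k l : (J < l)%N -> (shift_s m (f : P))`_k`_l = 0.
  move=> Jl; rewrite coef_map /=; apply: nth_default.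
  rewrite size_comp_poly2 ?size_XsubC //; exact: leq_trans (fJ k) _.
have J1 : (J < j.+1)%N by exact: ltnW.
rewrite !(coefZ, coefD, coefXM) (fun_if (fun p : {poly K} => p`_j.+1)) coef0 !sF //.
by rewrite if_same !mulr0 !addr0 mulr0.
Qed.

Lemma shift_coef_top m (f : bipoly K) J :
  (forall i, (size ((f : P)`_i)%R <= J.+1)%N) ->
  forall i, (shift_s m (f : P))`_i`_J = (f : P)`_i`_J /\
   ((0 < J)%N -> (shift_s m (f : P))`_i`_J.-1 =
     (f : P)`_i`_J.-1 - J%:R * m%:~R * (f : P)`_i`_J).
Proof. by move=> fJ i; rewrite coef_map /=; exact: comp_XsubC_top. Qed.

Lemma phi_L_top m (f : bipoly K) J :
  (forall i, (size ((f : P)`_i)%R <= J.+1)%N) ->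
  forall i, (phi_L lambda alpha h m f : P)`_i`_J.+1 = lam ^ m * (f : P)`_i`_J.
Proof.
move=> fJ i; rewrite phi_L_coef.
have sF k : (shift_s m (f : P))`_k`_J.+1 = 0.
  rewrite coef_map /=; apply: nth_default.
  rewrite size_comp_poly2 ?size_XsubC //; exact: fJ.
rewrite !(coefZ, coefD, coefXM) !sF (shift_coef_top m fJ i).1.
rewrite (fun_if (fun p : {poly K} => p`_J.+1)) coef0 sF if_same.
by rewrite !mulr0 !addr0.
Qed.

(** Up to lam^m the coefficient is quadratic in m. Its m^2 term is explicit, since (S - lam)^2 will
    isolate it. *)
Lemma phi_L_quadratic (f : bipoly K) J :
  (forall i, (size ((f : P)`_i)%R <= J.+1)%N) ->
  forall i, exists e0 e1 : K, forall m : int,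
  (phi_L lambda alpha h m f : P)`_i`_J = lam ^ m * (e0 + m%:~R * e1 + m%:~R ^+ 2 *
    (alp * i.+1%:R * (f : P)`_i.+1`_J - alp * g0 * (f : P)`_i`_J)).
Proof.
move=> fJ i.
(* For J = 0 the truncated predecessor is 0 again, while the coefficient of s^(-1) must count as
   0. *)
exists (if (J == 0)%N then 0 else (f : P)`_i`_J.-1).
exists ((if (J == 0)%N then 0 else - (J%:R * (f : P)`_i`_J))
  + (h0 + alp * g0 - i%:R) * (f : P)`_i`_J
  + g0 * (if (i == 0)%N then 0 else (f : P)`_i.-1`_J)) => m.
rewrite phi_L_coef !(coefZ, coefD, coefXM).
rewrite (fun_if (fun p : {poly K} => p`_J)) coef0.
have top k := (shift_coef_top m fJ k).1.
rewrite !top; congr (_ * _).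
case: (posnP J) => [J0|J0]; first by rewrite J0; ring.
by rewrite (shift_coef_top m fJ i).2 //; ring.
Qed.

End PhiLinear.

Section PhiKilled.
Variables (K : numFieldType) (lambda alpha : nonzero K) (h : {poly K}).
Local Notation lam := (val lambda).
Local Notation alp := (val alpha).
Local Notation P := {poly {poly K}}.

Definition bimul (p : P) (f : bipoly K) : bipoly K := p * (f : P).

Lemma bimul_linear (p : P) : linear (bimul p).
Proof.
move=> a f g; rewrite /bimul -[RHS]/(a%:P%:P * (p * f) + p * g : P).
rewrite -[X in p * X]/(a%:P%:P * (f : P) + g : P); ring.
Qed.

Definition bideriv (f : bipoly K) : bipoly K := (f : P)^`().

Lemma bideriv_linear : linear bideriv.
Proof.
move=> a f g; rewrite /bideriv -[RHS]/(a%:P%:P * (f : P)^`() + (g : P)^`() : P).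
rewrite -[X in X^`()]/(a%:P%:P * (f : P) + g : P).
by rewrite derivD derivM derivC mul0r add0r.
Qed.

Lemma bipoly_scaleE (a : K) (f : bipoly K) : a *: f = (a%:P%:P * (f : P) : P).
Proof. by []. Qed.

(** Induction on the powers of t, then of s: the shift leaves t alone and turns s into s - m, which
    raises the degree in m by at most one. *)
Lemma shift_killed (f : P) : exists d,
  killed lam d (fun m => lam ^ m *: (shift_s m f : bipoly K)).
Proof.
have l0 := valP lambda : lam != 0.
elim/poly_ind: f => [|f p [d hd]].
  exists 0%N => m; rewrite /= /shift_s raddf0; exact: scaler0.
suff [e he] : exists e, killed lam e (fun m => lam ^ m *: (shift_s m p%:P : bipoly K)).
  exists (maxn d e); apply: (@eq_killed _ (bipoly K) _ _ (fun m =>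
    bimul 'X (lam ^ m *: (shift_s m f : bipoly K))
    + lam ^ m *: (shift_s m p%:P : bipoly K))).
    move=> m; rewrite -[RHS]/((_%:P%:P * shift_s m _) : P).
    rewrite /shift_s rmorphD rmorphM /= map_polyX.
    by rewrite /bimul !bipoly_scaleE -[LHS]/(_ + _ : P); ring.
  apply: killedD; last exact: killed_leq (leq_maxr _ _) he.
  apply: (linear_killed (bimul_linear 'X)).
  exact: killed_leq (leq_maxl _ _) hd.
elim/poly_ind: p => [|p a [e he]].
  exists 0%N => m; rewrite /= polyC0 /shift_s raddf0; exact: scaler0.
exists e.+2; apply: (@eq_killed _ (bipoly K) _ _ (fun m =>
    bimul 'X%:P (lam ^ m *: (shift_s m p%:P : bipoly K))
    - m%:~R *: (lam ^ m *: (shift_s m p%:P : bipoly K))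
    + lam ^ m *: (a%:P%:P : bipoly K))).
  move=> m; rewrite -[RHS]/((_%:P%:P * shift_s m _) : P).
  rewrite /shift_s !map_polyC /= comp_polyD comp_polyM comp_polyX comp_polyC.
  rewrite /bimul !bipoly_scaleE -[LHS]/(_ - _ + _ : P) !(polyCM, polyCD, polyCN).
  by ring.
apply: killedD; last exact: killed_leq _ (killed_geom _ l0).
apply: killedB; last by apply: killed_leq (killed_mulX he).
apply: (linear_killed (bimul_linear 'X%:P)).
by apply: killed_leq he; lia.
Qed.

Lemma phi_L_killed (f : Phi lambda alpha h) :
  exists d, killed lam d (fun m => Lop m f).
Proof.
have [d hd] := shift_killed (f : P); exists d.+2.
pose F m := lam ^ m *: (shift_s m (f : P) : bipoly K).
have hF2 : killed lam d.+2 (fun m => m%:~R *: (m%:~R *: F m)).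
  exact: killed_mulX (killed_mulX hd).
have hF1 : killed lam d.+2 (fun m => m%:~R *: F m).
  exact: killed_leq (leqnSn _) (killed_mulX hd).
have hF0 : killed lam d.+2 F by apply: killed_leq hd; lia.
have mk p := linear_killed (bimul_linear p).
have dk := linear_killed bideriv_linear.
pose g := poly_t (phi_g alpha h); pose a : P := alp%:P%:P.
apply: (@eq_killed _ (bipoly K) _ _ (fun m =>
  bimul 'X%:P (F m) + bimul (poly_t h) (m%:~R *: F m)
  - bimul (a * g) (m%:~R *: (m%:~R *: F m)) + bimul (a * g) (m%:~R *: F m)
  - bimul 'X (bideriv (m%:~R *: F m))
  + bimul a (bideriv (m%:~R *: (m%:~R *: F m))))) => [m|].
  have intE (b : int) : b%:~R = (b%:~R : K)%:P%:P :> P by rewrite !rmorph_int.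
  rewrite -[RHS]/(phi_L lambda alpha h m f) /phi_L -/g -/a.
  rewrite /bimul /bideriv /F !bipoly_scaleE.
  rewrite -[LHS]/(_ + _ - _ + _ - _ + _ : P) !derivM !derivC !mul0r !add0r.
  rewrite !intE (intrM _ m) intrB.
  rewrite !(polyCM, polyCB) polyC1; ring.
apply: (@killedD _ (bipoly K)); last exact/mk/dk.
apply: (@killedB _ (bipoly K)); last exact/mk/dk.
apply: (@killedD _ (bipoly K)); last exact/mk.
apply: (@killedB _ (bipoly K)); last exact/mk.
apply: (@killedD _ (bipoly K)); exact/mk.
Qed.

End PhiKilled.

(** * The action on Phi (x) U for h of degree 1 *)

Section PhiTensorTheory.
Variables (K : numFieldType) (lambda alpha : nonzero K) (h : {poly K}).
Variables (g0 h0 : K).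

Hypothesis hE : h = g0 *: 'X + h0%:P.
Hypothesis gE : phi_g alpha h = g0%:P.
Variable U : lieModule (virasoro K).

Local Notation lam := (val lambda).
Local Notation alp := (val alpha).
Local Notation P := {poly {poly K}}.
Local Notation Phi := (Phi lambda alpha h).
Local Notation W := (tensor_module Phi U).
Local Opaque phi_L tens phi_coord.
Local Notation phiL := (phi_L lambda alpha h).
Local Notation L := (@Lop K _).
Local Notation phi_coord := (@phi_coord K lambda alpha h U).
Implicit Types (w : W) (u : U) (m : int).

Let l0 : lam != 0. Proof. exact: (valP lambda). Qed.
Let a0 : alp != 0. Proof. exact: (valP alpha). Qed.

Lemma LopE m (f : Phi) u :
  L m (tens f u : W) = tens (phiL m f : Phi) u + tens f (L m u).
Proof. exact: Lop_tens. Qed.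

Lemma LopW_linear m : linear (@Lop K W m).
Proof. exact: (@Lop_linear K W). Qed.

Lemma size_bimon_coef i j k J : (j <= J)%N ->
  (size ((bimon K i j : P)`_k)%R <= J.+1)%N.
Proof.
move=> jJ; rewrite coefCM coefXn; case: (k == i).
  by rewrite mulr1 size_polyXn.
by rewrite mulr0 size_poly0.
Qed.

(** Reduces linear identities in s-degree at most J to tensors of a monomial with a vector of U. *)
Lemma sdeg_le_eq0 (X : lmodType K) (E : W -> X) J w : linear E -> sdeg_le J w ->
  (forall i j u, (j <= J)%N -> E (tens (bimon K i j : Phi) u) = 0) -> E w = 0.
Proof.
move=> lE /sdeg_le_expand[B ->] E0; rewrite (linf_sum lE) big1 // => i _.
by rewrite (linf_sum lE) big1 // => j _; apply: E0; rewrite -ltnS.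
Qed.

Lemma phi_coord_Lop_pure i j m (f : Phi) u : phi_coord i j (L m (tens f u : W)) =
  (phiL m f : P)`_i`_j *: u + (f : P)`_i`_j *: L m u.
Proof.
rewrite LopE (linfD (phi_coord_linear i j)).
by apply: congr2; exact: phi_coordE.
Qed.

Lemma sdeg_le_Lop J w m : sdeg_le J w -> sdeg_le J.+1 (L m w : W).
Proof.
move=> wJ i j Jj.
apply: (sdeg_le_eq0 (E := fun w => phi_coord i j (L m w : W)) _ wJ) => [|i' j' u jJ].
  exact: lin_comp (phi_coord_linear i j) (LopW_linear m).
rewrite phi_coord_Lop_pure.
rewrite (phi_L_bound lambda hE gE m (fun k => size_bimon_coef i' k jJ)) //.
rewrite nth_default ?scale0r ?addr0 //.
by apply: leq_trans (size_bimon_coef i' i jJ) _; exact: ltnW.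
Qed.

Lemma phi_coord_Lop_top J w m i : sdeg_le J w ->
  phi_coord i J.+1 (L m w : W) = lam ^ m *: phi_coord i J w.
Proof.
move=> wJ; apply/eqP; rewrite -subr_eq0; apply/eqP.
apply: (sdeg_le_eq0 (E := fun w =>
  phi_coord i J.+1 (L m w : W) - lam ^ m *: phi_coord i J w) _ wJ).
  apply: lin_sub; last exact: lin_scale (phi_coord_linear _ _).
  exact: lin_comp (phi_coord_linear _ _) (LopW_linear m).
move=> i' j' u jJ; rewrite phi_coord_Lop_pure phi_coordE.
rewrite (phi_L_top lambda hE gE m (fun k => size_bimon_coef i' k jJ)).
rewrite [X in X *: L m u](nth_default 0); last exact: size_bimon_coef.
by rewrite scale0r addr0 scalerA subrr.
Qed.

(** Once the action on U is subtracted, lam^m times a quadratic in m remains, and (S - lam)^2 turns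
    lam^m m^2 into 2 lam^(m+2). *)
Lemma phi_coord_Lop_quadratic J w i : sdeg_le J w ->
  iter 2 (dop lam) (fun m => phi_coord i J (L m w : W) - L m (phi_coord i J w)) =1
  fun k => lam ^ k *: ((2 * lam ^+ 2) *: ((alp * i.+1%:R) *: phi_coord i.+1 J w
    - (alp * g0) *: phi_coord i J w)).
Proof.
move=> wJ k; apply/eqP; rewrite -subr_eq0; apply/eqP.
pose E w :=
  iter 2 (dop lam) (fun m => phi_coord i J (L m w : W) - L m (phi_coord i J w)) k
  - lam ^ k *: ((2 * lam ^+ 2) *: ((alp * i.+1%:R) *: phi_coord i.+1 J w
    - (alp * g0) *: phi_coord i J w)).
apply: (sdeg_le_eq0 (E := E) _ wJ) => [|i' j' u jJ].
  have la m : linear (fun w => phi_coord i J (L m w : W) - L m (phi_coord i J w)).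
    apply: lin_sub; last exact: lin_comp (@Lop_linear K U m) (phi_coord_linear _ _).
    exact: lin_comp (phi_coord_linear _ _) (LopW_linear m).
  apply: lin_sub; last first.
    do 2 apply: lin_scale.
    by apply: lin_sub; apply: lin_scale; exact: phi_coord_linear.
  by do 2 (apply: lin_sub; last apply: lin_scale).
pose f := bimon K i' j'.
have [e0 [e1 ef]] := phi_L_quadratic lambda hE gE (fun k => size_bimon_coef i' k jJ) i.
set e2 := _ - _ in ef.
have aE :
    (fun m => phi_coord i J (L m (tens f u : W)) - L m (phi_coord i J (tens f u : W)))
    =1 fun m => (lam ^ m * (e0 + m%:~R * e1 + m%:~R ^+ 2 * e2)) *: u.
  move=> m; rewrite phi_coord_Lop_pure phi_coordE (linfZ (@Lop_linear K U m)) addrK.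
  by rewrite ef.
rewrite /E (eq_iter_dop _ _ aE) !phi_coordE !scalerA -scalerBl scalerA.
rewrite /= /dop !scalerA -!scalerBl scalerA -!scalerBl -[RHS](scale0r u).
congr (_ *: _); rewrite -/f /e2 !expfzDr // !expr1z !rmorphD /=; ring.
Qed.

(** The p-th iterate on w has s-degree exactly J + p, whereas the s-degree is bounded on a
    finite-dimensional space. *)
Lemma not_locally_finite_Lop w m : w != 0 -> ~ locally_finite (@Lop K W m).
Proof.
move=> w0 /(_ w)[s [sw sL]].
have [J [i [wJ iJ _]]] := top_phi_coord w0; have [J' hJ'] := sdeg_le_bound s.
have spn p : in_span s (iter p (@Lop K W m) w) by elim: p => //= p; exact: sL.
have degs p : sdeg_le (J + p) (iter p (@Lop K W m) w).
  elim: p => [|p IHp]; first by rewrite addn0.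
  by rewrite addnS; exact: sdeg_le_Lop.
have ne p : phi_coord i (J + p) (iter p (@Lop K W m) w) != 0.
  elim: p => [|p IHp]; first by rewrite addn0.
  by rewrite addnS phi_coord_Lop_top // scaler_eq0 negb_or IHp expfz_neq0.
case/eqP: (ne J'.+1); apply: (in_span_eq0 (phi_coord_linear _ _)) (spn J'.+1).
by move=> x /hJ'; apply; lia.
Qed.

(** At the leading coordinate of w the neighbour at t^(i+1) vanishes, so the m^2 term is a nonzero
    multiple of alpha g0 times that coordinate. *)
Lemma not_almost_killed_Lop w : g0 != 0 -> w != 0 ->
  (forall u, almost_killed lam 0 (fun k => L k u)) ->
  ~ almost_killed lam 2 (fun k => L k w : W).
Proof.
move=> g0_neq0 w0 hU hw; have [J [i [wJ iJ imax]]] := top_phi_coord w0.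
have := almost_killed_lincomb (-1) (almost_killed_leq (leq0n 2) (hU (phi_coord i J w)))
  (linear_almost_killed (phi_coord_linear i J) hw).
have aE : (fun k => -1 *: L k (phi_coord i J w) + phi_coord i J (L k w : W)) =1
    fun k => phi_coord i J (L k w : W) - L k (phi_coord i J w).
  by move=> k; rewrite scaleN1r addrC.
move=> /(eq_almost_killed aE).
move=> /(almost_killed_geom l0 (phi_coord_Lop_quadratic i wJ))/eqP.
rewrite imax // scaler0 sub0r scalerN oppr_eq0 !scaler_eq0 (negPf iJ).
by rewrite !mulf_eq0 pnatr_eq0 (negPf l0) (negPf a0) (negPf g0_neq0).
Qed.

Definition phi1 : Phi := (1 : P).

(** The constant term in L_m 1 = lam^m (s + c(m) + m g0 t). *)
Let c (x : K) : K := x * h0 - x * (x - 1) * alp * g0.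

Lemma phi_L_1 m i : (phiL m phi1 : P)`_i = lam ^ m *:
  (if i is i'.+1 then (if i' is 0 then (m%:~R * g0)%:P else 0)
   else 'X + (c m%:~R)%:P).
Proof.
rewrite (phi_L_coef _ hE gE) /phi1; congr (_ *: _).
have -> : shift_s m 1 = 1 :> P by exact: rmorph1.
case: i => [|[|i]]; rewrite !coef1 /=.
- by rewrite !mulr1 !mulr0 !scaler0 !addr0 subr0 -mul_polyC mulr1.
- by rewrite !(mulr0, scaler0, add0r, addr0) -mul_polyC mulr1.
- by rewrite !(mulr0, scaler0, add0r, addr0).
Qed.

Lemma phi_L_L_1 l m : let x : K := m%:~R in let y : K := (l - m)%:~R in
  (phiL (l - m) (phiL m phi1) : P)`_0 = lam ^ l *:
    ('X * ('X + (c x - y)%:P) + c y *: ('X + (c x - y)%:P)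
     + (y ^+ 2 * alp * x * g0)%:P).
Proof.
move=> x y; rewrite (phi_L_coef _ hE gE) !coef_map /= !phi_L_1 -/x -/y.
have -> : lam ^ l = lam ^ (l - m) * lam ^ m by rewrite -expfzDr // subrK.
rewrite -[RHS]scalerA; congr (_ *: _).
rewrite !comp_polyZ comp_polyD comp_polyX !comp_polyC.
rewrite -!mul_polyC !(polyCM, polyCD, polyCB, polyCN) -/c.
rewrite !polyC1 !polyC0 !(mulr0, subr0, addr0) /c; ring.
Qed.

(** The coordinate at s sees both cross terms, as L_m 1 has s-coefficient lam^m, but not 1 (x)
    L_(l-m) L_m u, as 1 has none. *)
Lemma pair_phi_coord01 l m u :
  phi_coord 0 1 (L (l - m) (L m (tens phi1 u : W) : W) : W) =
  (lam ^ l * (c m%:~R - (l - m)%:~R + c (l - m)%:~R)) *: u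
  + (lam ^ m *: L (l - m) u + lam ^ (l - m) *: L m u).
Proof.
rewrite LopE (linfD (LopW_linear _)) (linfD (phi_coord_linear 0 1)).
apply: (etrans (congr2 +%R
  (phi_coord_Lop_pure 0 1 (l - m) (phiL m phi1 : Phi) u)
  (phi_coord_Lop_pure 0 1 (l - m) phi1 (L m u)))).
have e1 : (phiL (l - m) (phiL m phi1) : P)`_0`_1 =
    lam ^ l * (c m%:~R - (l - m)%:~R + c (l - m)%:~R).
  by rewrite phi_L_L_1 !(coefZ, coefD, coefXM, coefC, coefX) /=; ring.
have e2 k : (phiL k phi1 : P)`_0`_1 = lam ^ k.
  by rewrite phi_L_1 !(coefZ, coefD, coefC, coefX) /= addr0 mulr1.
have e3 : (phi1 : P)`_0`_1 = 0 by rewrite coef1 coefC.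
by rewrite e1 !e2 e3 scale0r addr0 [RHS]addrA.
Qed.

(** * Triviality of U when L_(l-m) L_m w is polynomial in m *)

Section Trivial.
Variable R : nat.
Hypothesis pair_killed : forall l w,
  killed 1 R (fun m => L (l - m) (L m w : W) : W).

Let nrm u m : U := lam ^ (- m) *: L m u.

(** These are the cross terms of [pair_phi_coord01] divided by lam^l; its other term is quadratic in
    m, whence the 3. *)
Let nrm_pair_killed l u : killed 1 (maxn R 3) (fun m => nrm u (l - m) + nrm u m).
Proof.
have := linear_killed (phi_coord_linear 0 1)
  (killed_leq (leq_maxl R 3) (pair_killed l (tens phi1 u))).
pose q : K := l%:~R.
have quad : killed 1 (maxn R 3) (fun m =>
    (lam ^ l * (c m%:~R - (l - m)%:~R + c (l - m)%:~R)) *: u).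
  apply: (killed_leq (leq_maxr R 3)).
  apply: (@eq_killed _ _ _ _ (fun m => (lam ^ l * (- q + c q)) *: u
    + m%:~R *: ((lam ^ l * (1 + (q + q) * alp * g0)) *: u)
    + m%:~R *: (m%:~R *: ((lam ^ l * (- (alp * g0) - (alp * g0))) *: u)))) => [m|].
    rewrite !scalerA -!scalerDl; congr (_ *: _).
    by rewrite /c /q !rmorphB /=; ring.
  apply: killedD; last by apply/killed_mulX/killed_mulX/killed_const.
  apply: killedD; first exact: killed_leq (killed_const _).
  apply: (@killed_leq _ _ _ 2) => //; exact/killed_mulX/killed_const.
move=> /killedB/(_ quad)/(killedZ (lam ^ (- l))); apply: eq_killed => m.
rewrite pair_phi_coord01 addrC addKr scalerDr !scalerA /nrm.
by rewrite -!expfzDr //; congr (_ ^ _ *: _ + _ ^ _ *: _); lia.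
Qed.

(** The d-th difference of m |-> nrm u (l - m) depends on l - m only. Taking l = m, the d-th
    difference of nrm u is constant, and one more annihilates it. *)
Let nrm_killed u : killed 1 (maxn R 3).+1 (nrm u).
Proof.
set d := maxn R 3; pose G x := iter d (dop 1) (fun k => nrm u (x - k)) 0.
have GD l m : G (l - m) + iter d (dop 1) (nrm u) m = 0.
  have e : iter d (dop 1) (fun k => nrm u (l - k) + nrm u k) m =
      iter d (dop 1) (fun k => nrm u (l - k)) m + iter d (dop 1) (nrm u) m.
    rewrite -[X in X + _]scale1r -iter_dop_lincomb.
    by apply: eq_iter_dop => k; rewrite scale1r.
  rewrite -[RHS](nrm_pair_killed l u m) -/d e; congr (_ + _).
  rewrite -[in RHS](add0r m) -iter_dop_shift.
  by apply: eq_iter_dop => k; congr nrm; lia.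
move=> k; rewrite iterS /dop scale1r.
have e m : iter d (dop 1) (nrm u) m = - G 0.
  by apply/eqP; rewrite -addr_eq0 addrC -{1}(subrr m) GD.
by rewrite !e subrr.
Qed.

(** m a_m = [L_0, a_m] is killed at order d + 1, by the hypothesis at u and at L_0 u; this is why
    the bound must be uniform in u. The Leibniz rule then leaves d + 1 times the d-th difference of
    a. *)
Let nrm_descent d : (forall u, killed 1 d.+1 (nrm u)) -> forall u, killed 1 d (nrm u).
Proof.
move=> hd u k.
(* At k - 1, because the Leibniz rule takes the lower difference at the next index. *)
have := iter_dop_mulX 1 d (nrm u) (k - 1).
rewrite hd scaler0 add0r subrK.
have -> : iter d.+1 (dop 1) (fun j => j%:~R *: nrm u j) (k - 1) = 0.
  have hL : killed 1 d.+1 (fun j => L 0 (nrm u j) - nrm (L 0 u) j).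
    apply: killedB; last exact: hd.
    exact: linear_killed (@Lop_linear K U 0) (hd u).
  suff : killed 1 d.+1 (fun j => j%:~R *: nrm u j) by exact.
  apply: eq_killed hL => j.
  rewrite /nrm (linfZ (@Lop_linear K U 0)) -scalerBr Lop_br add0r subr0.
  by rewrite expr0n subrr mul0r if_same scale0r addr0 !scalerA mulrC.
by move/esym/eqP; rewrite scaler_eq0 pnatr_eq0 /= => /eqP.
Qed.

Lemma pair_killed_trivial m u : L m u = 0.
Proof.
have : forall u, killed 1 0 (nrm u).
  have : forall u, killed 1 (maxn R 3).+1 (nrm u) by exact: nrm_killed.
  by elim: (maxn R 3).+1 => // d IHd hd; apply: IHd; exact: nrm_descent.
move=> /(_ u m) /= /eqP; rewrite scaler_eq0 (negPf (expfz_neq0 _ l0)) /=.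
by move/eqP.
Qed.

End Trivial.

Hypothesis U_trivial : forall m u, L m u = 0.

Lemma trivial_Lop_killed w : exists d, killed lam d (fun m => L m w : W).
Proof.
elim/tensor_ind: w => [x y [d hd] [e he]|f u].
  exists (maxn d e); apply: (@eq_killed _ _ _ _
     (fun m => (L m (x : W) : W) + (L m (y : W) : W))) => [m|].
    by rewrite (linfD (LopW_linear m)).
  by apply: killedD; [exact: killed_leq (leq_maxl _ _) hd
                     |exact: killed_leq (leq_maxr _ _) he].
have [d hd] := phi_L_killed (f : Phi); exists d.
apply: eq_killed (linear_killed (@tens_linearl K Phi U u) hd) => m.
by rewrite LopE U_trivial (linf0 (@tens_linearr _ _ _ _)) addr0.
Qed.

(** The constant coordinate of L_(-m) L_m (1 (x) u) is a quartic in m times u, with leading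
    coefficient (alpha g0)^2. *)
Lemma trivial_not_pair_killed w : g0 != 0 -> w != 0 ->
  ~ (forall w, killed 1 3 (fun m => L (- m) (L m w : W) : W)).
Proof.
move=> g0_neq0 w0 hk; have [J [i [_ iJ _]]] := top_phi_coord w0.
set u := phi_coord i J w in iJ.
have : killed 1 4 (fun m => phi_coord 0 0 (L (- m) (L m (tens phi1 u : W) : W) : W)).
  apply: (linear_killed (phi_coord_linear 0 0)); exact: killed_leq (hk _).
pose q (x : K) : K := c (- x) * (c x + x) + (- x) ^+ 2 * alp * x * g0.
move=> /(@eq_killed _ _ _ _ _ (fun m : int => q m%:~R *: u)).
have e m : phi_coord 0 0 (L (- m) (L m (tens phi1 u : W) : W) : W) = q m%:~R *: u.
  have trivE k (f : Phi) : L k (tens f u : W) = tens (phiL k f : Phi) u.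
    apply: (etrans (LopE k f u)).
    by rewrite U_trivial (linf0 (@tens_linearr K Phi U f)) addr0.
  apply: (etrans (congr1 (phi_coord 0 0) (etrans
    (congr1 (@Lop K W (- m)) (trivE m phi1)) (trivE (- m) (phiL m phi1))))).
  apply: (etrans (phi_coordE 0 0 (phiL (- m) (phiL m phi1) : Phi) u)).
  congr (_ *: _); have := phi_L_L_1 0 m; rewrite sub0r => -> /=.
  rewrite expr0z scale1r !(coefZ, coefD, coefXM, coefC, coefX) /= /q rmorphN /=.
  by rewrite /c; ring.
move=> /(_ e)/(_ 0); rewrite /= /dop /= !scale1r -!scalerBl.
move/eqP; rewrite scaler_eq0 (negPf iJ) orbF.
(* The fourth difference of the quartic is 4! times its leading coefficient. *)
set z := (X in X == 0); suff -> : z = 24 * (alp * g0) ^+ 2.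
  rewrite mulf_eq0 pnatr_eq0 /= expf_eq0 /= mulf_eq0.
  by rewrite (negPf a0) (negPf g0_neq0).
by rewrite /z /q /c; ring.
Qed.

End PhiTensorTheory.

(** * The other modules *)

(** Since t^(l-m) t^m = t^l, m enters only through scalar coefficients, of degree at most 2. *)
Lemma intermediate_pair_killed (K : numFieldType) (A : laurentDModule K) (b : K)
    (l : int) (w : Intermediate A b) :
  killed 1 3 (fun m => Lop (l - m) (Lop m w)).
Proof.
pose x0 : A := lmon l (euler (euler w)); pose x1 : A := lmon l (euler w).
pose x2 : A := lmon l w.
apply: (@eq_killed _ A _ _ (fun m => (x0 + (l%:~R * b) *: x1)
  + m%:~R *: (x1 + (l%:~R * b ^+ 2) *: x2)
  + m%:~R *: (m%:~R *: ((b - b ^+ 2) *: x2)))) => [m|].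
  rewrite -[RHS]/(interm_L b (l - m) (interm_L b m w)) /interm_L.
  rewrite (linfD (@euler_linear _ A)) (linfZ (@euler_linear _ A)) !eulerD.
  rewrite !(linfD (@lmon_linear _ A _)) !(linfZ (@lmon_linear _ A _)).
  rewrite !(linfD (@lmon_linear _ A _)) !(linfZ (@lmon_linear _ A _)).
  rewrite -!lmonD subrK -/x0 -/x1 -/x2 !scalerDr !scalerA !addrA.
  rewrite [LHS](ACl (1*(2*3)*(4*5))) [RHS](ACl (1*(2*3*5)*(4*6))) /= -!scalerDl.
  by rewrite !rmorphB /=; congr (_ + _ *: _ + _ *: _); ring.
apply: killedD; last by apply/killed_mulX/killed_mulX/killed_const.
apply: killedD; first exact: killed_leq (killed_const _).
by apply: (@killed_leq _ _ _ 2) => //; exact/killed_mulX/killed_const.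
Qed.

Lemma killed_pow (K : numFieldType) (U : lmodType K) (l : int) i j (x : U) :
  killed 1 (i + j).+1 (fun m => ((l - m)%:~R ^+ i * m%:~R ^+ j) *: x).
Proof.
elim: j => [|j IHj].
  rewrite addn0; elim: i => [|i IHi].
    apply: eq_killed (killed_const x) => m.
    by rewrite !expr0 mulr1 scale1r.
  apply: (eq_killed (a := fun m => l%:~R *: (((l - m)%:~R ^+ i * m%:~R ^+ 0) *: x)
     - m%:~R *: (((l - m)%:~R ^+ i * m%:~R ^+ 0) *: x))) => [m|].
    by rewrite -scalerBl scalerA -rmorphB mulrA -exprS.
  apply: killedB; last exact: killed_mulX.
  by apply: killedZ; exact: killed_leq IHi.
rewrite addnS; apply: eq_killed (killed_mulX IHj) => m.
by rewrite scalerA mulrCA -exprS.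
Qed.

(** * The modules N(M, gamma) *)

Section Loop.
Variables (K : numFieldType) (r : nat) (M : lieModule (trunc_virasoro K r)).
Variable gamma : {poly K}.
Local Notation N := (LoopModule M gamma).
Local Notation laurent := {malg K[int]}.
Local Notation L := (@Lop K N).

Lemma loop_LopE n (v : M) k : L n (tens v << k >>) =
  tens (k%:~R *: v + loop_X n v) << n + k >> + tens v (laurent_mul gamma (n + k)).
Proof. exact: loop_LE. Qed.

Lemma loop_L_lin n : linear (L n).
Proof. exact: (@Lop_linear K N). Qed.

Lemma Lbar_lin i : linear (@Lbar K r M i).
Proof. exact: act_linear. Qed.

Lemma loop_X_killed n (v : M) : killed 1 r.+2 (fun m => loop_X (n - m) v).
Proof.
rewrite /loop_X; apply: killed_sum => i.
apply: (eq_killed (a := fun m => ((i.+1)`!%:R)^-1 *: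
  (((n - m)%:~R ^+ i.+1 * m%:~R ^+ 0) *: Lbar i v))) => [m|].
  by rewrite scalerA expr0 mulr1 mulrC.
apply/killedZ/killed_leq/killed_pow; by rewrite addn0 ltnS ltn_ord.
Qed.

Lemma loop_X_killed0 (v : M) : killed 1 r.+2 (fun m => loop_X m v).
Proof.
rewrite /loop_X; apply: killed_sum => i.
apply: (eq_killed (a := fun m => ((i.+1)`!%:R)^-1 *:
  (((0 - m)%:~R ^+ 0 * m%:~R ^+ i.+1) *: Lbar i v))) => [m|].
  by rewrite scalerA expr0 mul1r mulrC.
apply/killedZ/killed_leq/killed_pow; by rewrite add0n ltnS ltn_ord.
Qed.

Lemma loop_XX_killed n (v : M) :
  killed 1 (2 * r + 4) (fun m => loop_X (n - m) (loop_X m v)).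
Proof.
apply: (eq_killed (a := fun m => \sum_(i < r.+1) \sum_(j < r.+1)
  (((i.+1)`!%:R)^-1 * ((j.+1)`!%:R)^-1) *:
     (((n - m)%:~R ^+ i.+1 * m%:~R ^+ j.+1) *: Lbar i (Lbar j v)))) => [m|].
  rewrite /loop_X; apply: eq_bigr => i _.
  rewrite (linf_sum (Lbar_lin i)) scaler_sumr; apply: eq_bigr => j _.
  by rewrite (linfZ (Lbar_lin i)) !scalerA; congr (_ *: _); ring.
apply: killed_sum => i; apply: killed_sum => j.
apply/killedZ/killed_leq/killed_pow.
have := ltn_ord i; have := ltn_ord j; lia.
Qed.

(** The shifts by m and l - m of the powers of t add up to l, so m remains only in the factors from
    M, polynomially and with a degree bounded in terms of r alone. *)
Lemma loop_pair_killed l (x : N) :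
  killed 1 (2 * r + 4) (fun m => L (l - m) (L m x)).
Proof.

elim/tensor_ind: x => [x y hx hy|v p].
  apply: eq_killed (killedD hx hy) => m.
  by rewrite (linfD (loop_L_lin m)) (linfD (loop_L_lin _)).
pose d := (2 * r + 4)%N.
(* For fixed k the iterated difference is linear in p, which reduces the claim to p = t^i. *)
have lE k : linear (fun p : laurent =>
    iter d (dop 1) (fun m => L (l - m) (L m (tens v p : N))) k).
  move=> a p1 p2; rewrite -iter_dop_lincomb; apply: eq_iter_dop => m.
  by rewrite (@tens_linearr _ _ _ v) !loop_L_lin.
move=> k; apply: (malg_lin_ext (lE k) (g := fun=> 0)) => [a _ _|i].
  by rewrite scaler0 addr0.
move: k; rewrite -/(killed 1 d _).
have tl (w : laurent) := @tens_linearl K M laurent w.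
have tr := @tens_linearr K M laurent v.
apply: (@eq_killed _ N _ _ (fun m =>
   (tens (i%:~R *: v + loop_X m v) (laurent_mul gamma (l + i))
    + tens ((m%:~R + i%:~R) *: (i%:~R *: v + loop_X m v) +
            (i%:~R *: loop_X (l - m) v + loop_X (l - m) (loop_X m v))) << l + i >>)
   + \sum_(j < size gamma) gamma`_j *:
      (tens (m%:~R *: v + ((i%:~R + j%:R) *: v + loop_X (l - m) v)) << l + i + j%:Z >>
       + tens v (laurent_mul gamma (l + i + j%:Z))))) => [m|].
  apply/esym/(etrans (congr1 (L (l - m)) (loop_LopE m v i))).
  apply: (etrans (linfD (loop_L_lin (l - m)) _ _)); apply: congr2.
    apply: (etrans (loop_LopE (l - m) (i%:~R *: v + loop_X m v) (m + i))).
    have -> : l - m + (m + i) = l + i by rewrite addrA subrK.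
    rewrite [RHS]addrC -rmorphD -(linfZ (@loop_X_linear K r M (l - m))).
    by rewrite -(linfD (@loop_X_linear K r M (l - m))).
  apply: (etrans (congr1 (L (l - m)) (linf_sum tr _ _ _))).
  apply: (etrans (linf_sum (loop_L_lin (l - m)) _ _ _)).
  apply: eq_bigr => j _; rewrite (linfZ tr).
  apply: (etrans (linfZ (loop_L_lin (l - m)) _ _)); apply: congr1.
  apply: (etrans (loop_LopE (l - m) v (m + i + j%:Z))).
  have -> : l - m + (m + i + j%:Z) = l + i + j%:Z by rewrite !addrA subrK.
  by rewrite !rmorphD /= scalerDl scalerDl scalerDl !addrA.
have hX : killed 1 r.+2 (fun m => i%:~R *: v + loop_X m v).
  apply: killedD; last exact: loop_X_killed0.
  exact: killed_leq (killed_const _).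
apply: (@killedD _ N); first apply: (@killedD _ N).
- apply: (linear_killed (tl _)); apply: killed_leq hX; rewrite /d; lia.
- apply: (linear_killed (tl _)); apply: killedD.
    apply: (eq_killed (a := fun m => m%:~R *: (i%:~R *: v + loop_X m v)
       + i%:~R *: (i%:~R *: v + loop_X m v))) => [m|]; first by rewrite scalerDl.
    apply: killedD; last by apply: killedZ; apply: killed_leq hX; rewrite /d; lia.
    by apply: killed_leq (killed_mulX hX); rewrite /d; lia.
  apply: killedD; last exact: loop_XX_killed.
  by apply: killedZ; apply: (killed_leq _ (loop_X_killed _ _)); rewrite /d; lia.
- apply: (@killed_sum _ N) => j; apply: (@killedZ _ N); apply: (@killedD _ N); last first.
    by apply: (killed_leq _ (killed_const _)); rewrite /d; lia.
  apply: (linear_killed (tl _)); apply: killedD.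
    by apply: (killed_leq _ (killed_mulX (killed_const _))); rewrite /d; lia.
  apply: killedD; first by apply: (killed_leq _ (killed_const _)); rewrite /d; lia.
  by apply: (killed_leq _ (loop_X_killed _ _)); rewrite /d; lia.
Qed.

Definition loop_coord0 : N -> M := tlift (fun v (p : laurent) => p@_0 *: v).

Lemma loop_coord0_linl (p : laurent) : linear (fun v : M => p@_0 *: v).
Proof. by move=> a u v; rewrite scalerDr !scalerA mulrC. Qed.

Lemma loop_coord0_linr (v : M) : linear (fun p : laurent => p@_0 *: v).
Proof. by move=> a p q; rewrite mcoeffD mcoeffZ scalerDl scalerA. Qed.

Lemma loop_coord0_linear : linear loop_coord0.
Proof. exact: (tlift_linear loop_coord0_linl loop_coord0_linr). Qed.

Lemma loop_coord0E v p : loop_coord0 (tens v p) = p@_0 *: v.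
Proof. exact: (tliftE loop_coord0_linl loop_coord0_linr). Qed.

(* The sequence of coefficients of t^0 in the L_n (v (x) 1) starts at
   n = - deg gamma. *)
Lemma loop_not_killed (v : M) rho d : v != 0 -> (1 < size gamma)%N ->
  ~ killed rho d (fun n => L n (tens v << 0 >>)).
Proof.
move=> v0 sg /(linear_killed loop_coord0_linear).
pose n0 : int := - (size gamma).-1%:Z.
(* For n < 0 the term in t^n has no t^0 part; only v (x) t^n gamma(t) contributes. *)
have aE n : n < 0 -> loop_coord0 (L n (tens v << 0 >>)) =
    (\sum_(j < size gamma) gamma`_j * (n + j%:Z == 0)%:R) *: v.
  move=> n_lt0; apply: (etrans (congr1 loop_coord0 (loop_LopE n v 0))).
  apply: (etrans (linfD loop_coord0_linear _ _)).
  apply: (etrans (congr2 +%R (loop_coord0E _ _) (loop_coord0E _ _))); rewrite addr0.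
  rewrite mcoeffU [n == 0]lt_eqF // scale0r add0r; congr (_ *: _).
  have l0 : linear (fun p : laurent => p@_0 : K^o).
    by move=> a p q; rewrite mcoeffD mcoeffZ.
  apply: (etrans (linf_sum l0 _ _ _)); apply: eq_bigr => j _.
  by rewrite mcoeffZ mcoeffU.
(* Each S - rho moves the first nonzero entry one place to the left and keeps its value. *)
move=> h; have : forall e, (forall n, n < n0 - e%:Z -> iter e (dop rho)
    (fun n => loop_coord0 (L n (tens v << 0 >>))) n = 0) /\
    iter e (dop rho) (fun n => loop_coord0 (L n (tens v << 0 >>))) (n0 - e%:Z) != 0.
  elim=> [|e [IH0 IH1]].
    rewrite subr0; split=> [n nn|] /=.
      rewrite aE; last by lia.
      rewrite big1 ?scale0r // => j _; rewrite (_ : (_ == _) = false) ?mulr0 //.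
      by apply/eqP; have := ltn_ord j; lia.
    rewrite aE; last by lia.
    have lt : ((size gamma).-1 < size gamma)%N by lia.
    rewrite (bigD1 (Ordinal lt)) //= big1 ?addr0.
      rewrite /n0 addNr eqxx mulr1 scaler_eq0 negb_or v0 andbT.
      by rewrite -/(lead_coef gamma) lead_coef_eq0 -size_poly_eq0 -lt0n ltnW.
    move=> j ne; rewrite (_ : (_ == _) = false) ?mulr0 //; apply/eqP => je.
    by case/eqP: ne; apply: val_inj; move/eqP: je; rewrite /n0 addrC subr_eq0 => /eqP[].
  split=> [n nn|]; rewrite iterS /dop.
    by rewrite !IH0 ?scaler0 ?subrr //; lia.
  rewrite [X in rho *: X]IH0; last by lia.
  rewrite scaler0 subr0; have -> // : n0 - e.+1%:Z + 1 = n0 - e%:Z by lia.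
by move=> /(_ d)[_]; rewrite h eqxx.
Qed.

End Loop.

(** * Tensor products with Omega(mu, b), and the remaining factors Phi *)

Section OmegaTensor.
Variables (K : numFieldType) (mu : nonzero K) (b : K) (U : lieModule (virasoro K)).

Definition omega1 : Omega mu b := (1 : {poly K}).

(** L_k 1 = mu^k (t + k (b - 1)) has degree at most 1 in k, so order 2 suffices even if mu = lam. *)
Lemma omega_tens_almost_killed lam (u : U) :
  almost_killed lam 2 (fun k => Lop k u) ->
  almost_killed lam 2 (fun k => Lop k (tens omega1 u : tensor_module (Omega mu b) U)).
Proof.
move=> hu; have m0 := valP mu : val mu != 0.
have tl := @tens_linearl K (Omega mu b) U u.
have omegaE k : Lop k omega1 =
    (val mu ^ k *: 'X + k%:~R *: (val mu ^ k *: (b - 1)%:P) : Omega mu b).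
  rewrite -[LHS]/(omega_L mu b k 1) /omega_L -polyC1 comp_polyC mul1r scalerDr.
  by rewrite polyCM -!mul_polyC; ring.
apply: (eq_almost_killed (a := fun k =>
  (tens (val mu ^ k *: 'X + k%:~R *: (val mu ^ k *: (b - 1)%:P) : Omega mu b) u
   : tensor_module (Omega mu b) U) + tens omega1 (Lop k u))) => [k|].
  apply/esym/(etrans (Lop_tens k omega1 u)).
  apply: congr2; last by [].
  exact: (congr1 (fun f : Omega mu b => tens f u) (omegaE k)).
apply: (@almost_killedD _ (tensor_module (Omega mu b) U)); last first.
  exact: linear_almost_killed (@tens_linearr _ _ _ _) hu.
apply: (linear_almost_killed tl).
apply: (@killed_almost_killed _ (Omega mu b) _ (val mu) _ 2) => //.
apply: (@killedD _ (Omega mu b)); first by apply: (killed_leq _ (killed_geom _ m0)).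
exact/killed_mulX/killed_geom.
Qed.

Lemma omega_tens_neq0 (u : U) : u != 0 -> tens omega1 u != 0.
Proof.
apply: contraNneq => e.
have ll (v : U) : linear (fun f : Omega mu b => (f : {poly K})`_0 *: v).
  by move=> a f g; rewrite coefD coefZ scalerDl scalerA.
have lr (f : Omega mu b) : linear (fun v : U => (f : {poly K})`_0 *: v).
  by move=> a v w; rewrite scalerDr !scalerA mulrC.
have := tliftE ll lr omega1 u; rewrite e (linf0 (tlift_linear ll lr)) => ->.
by rewrite coef1 scale1r.
Qed.

End OmegaTensor.

Lemma omega_list_almost_killed (K : numFieldType) (I : Type) (s : seq I)
    (mu : I -> nonzero K) (b : I -> K) (V : lieModule (virasoro K)) lam :
  (exists v : V, v != 0) -> (forall v : V, eventually0 (fun k => Lop k v)) ->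
  exists2 w : tensor_list [seq Omega (mu i) (b i) | i <- s] V, w != 0 &
    almost_killed lam 2 (fun k => Lop k w).
Proof.
move=> [v v0] hV; elim: s => [|i s [w w0 hw]] /=.
  by exists v => //; apply: eventually0_almost_killed.
by exists (tens (omega1 (mu i) (b i)) w);
  [exact: omega_tens_neq0 | exact: omega_tens_almost_killed].
Qed.

(** The sequence coming from Phi has ratio lambda, different from lam, and is absorbed by the factor
    Q. *)
Lemma phi_tens_almost_killed (K : numFieldType) (lambda alpha : nonzero K)
    (h : {poly K}) (Y : lieModule (virasoro K)) lam :
  val lambda != lam -> (forall u : Y, almost_killed lam 0 (fun k => Lop k u)) ->
  forall w : tensor_module (Phi lambda alpha h) Y,
    almost_killed lam 0 (fun k => Lop k w).
Proof.
set X := Phi _ _ _ => ne hY; elim/tensor_ind => [x y hx hy|f u].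
  apply: eq_almost_killed (almost_killedD hx hy) => k.
  exact/esym/(linfD (@Lop_linear K (tensor_module X Y) k)).
apply: (eq_almost_killed (a := fun k =>
   (tens (Lop k f) u : tensor_module X Y) + tens f (Lop k u))) => [k|].
  exact/esym/(Lop_tens k f u).
apply: (@almost_killedD _ (tensor_module X Y)); last first.
  exact: linear_almost_killed (@tens_linearr _ _ _ _) (hY u).
apply: (linear_almost_killed (@tens_linearl _ X Y u)).
have [d hd] := phi_L_killed f.
by apply: killed_almost_killed hd => e; rewrite e eqxx in ne.
Qed.

Lemma phi_list_almost_killed (K : numFieldType) (I : eqType) (s : seq I)
    (lambda alpha : I -> nonzero K) (h : I -> {poly K}) (V : lieModule (virasoro K))
    lam : (forall i, i \in s -> val (lambda i) != lam) ->
  (forall v : V, eventually0 (fun k => Lop k v)) ->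
  forall w : tensor_list [seq Phi (lambda i) (alpha i) (h i) | i <- s] V,
    almost_killed lam 0 (fun k => Lop k w).
Proof.
move=> hs hV; elim: s hs => [|i s IHs] hs w.
  exact: eventually0_almost_killed.
apply: phi_tens_almost_killed w; first by apply: hs; rewrite mem_head.
by apply: IHs => j js; apply: hs; rewrite inE js orbT.
Qed.

(** * Non-isomorphism *)

Lemma isomorphic_neq0 (K : fieldType) (g : lieAlgebra K) (V W : lieModule g)
    (f : V -> W) :
  linear f -> bijective f -> (exists w : W, w != 0) -> exists v : V, v != 0.
Proof.
move=> lf [f' f'K fK'] [w w0]; exists (f' w); apply: contraNneq w0 => e.
by rewrite -(fK' w) e (linf0 lf).
Qed.

Lemma locally_finite_iso (K : fieldType) (V W : lmodType K) (f : V -> W) T S :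
  linear f -> bijective f -> (forall v, f (T v) = S (f v)) ->
  locally_finite S -> locally_finite T.
Proof.
move=> lf [f' f'K fK'] fT lfS v; have [s [sv sS]] := lfS (f v).
have lf' : linear f'.
  by move=> a x y; apply: (can_inj f'K); rewrite lf !fK'.
exists (map f' s); split; first by rewrite -[v]f'K; exact: in_span_map.
move=> u us; rewrite -[T u]f'K fT; apply: in_span_map => //; apply: sS.
have := in_span_map lf us; rewrite -map_comp.
by rewrite (eq_map (g := id)) ?map_id.
Qed.

Section PhiTensorNotIsomorphic.
Variables (K : numFieldType) (lambda alpha : nonzero K) (h : {poly K}).
Hypothesis size_h : size h = 2%N.
Variables (U X : lieModule (virasoro K)).
Local Notation W := (tensor_module (Phi lambda alpha h) U).
Hypothesis WX : isomorphic W X.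
Hypothesis X_neq0 : exists x : X, x != 0.

Lemma iso_not_eventually_locally_finite : ~ eventually_locally_finite X.
Proof.
move=> [R lfX]; have [g0 [h0 [g00 hE gE]]] := phi_coefs_linear alpha size_h.
have [f [lf bf fL]] := WX; have [w w0] := isomorphic_neq0 lf bf X_neq0.
refine (not_locally_finite_Lop hE gE w0 (m := R%:Z) _).
exact: (locally_finite_iso lf bf (fL (VirL R%:Z)) (lfX _ (lexx _))).
Qed.

Section PairKilled.
Variable R : nat.
Hypothesis X_pair : forall l (x : X), killed 1 R (fun m => Lop (l - m) (Lop m x)).

Lemma iso_pair_killed l (w : W) : killed 1 R (fun m => Lop (l - m) (Lop m w)).
Proof.
have [f [lf bf fL]] := WX; apply: (killed_inj lf (bij_inj bf)).
apply: eq_killed (X_pair l (f w)) => m.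
exact/esym/(etrans (fL (VirL (l - m)) _))/(congr1 (Lop (l - m)))/(fL (VirL m)).
Qed.

Lemma iso_trivial m (u : U) : Lop m u = 0.
Proof.
have [g0 [h0 [_ hE gE]]] := phi_coefs_linear alpha size_h.
exact: (pair_killed_trivial hE gE iso_pair_killed m u).
Qed.

(** U being trivial, the growth of the action on Phi alone is carried over to X. *)
Lemma iso_pair_killed_Lop_killed (x : X) : exists d,
  killed (val lambda) d (fun m => Lop m x).
Proof.
have [f [lf [f' f'K fK'] fL]] := WX.
have [d hd] := trivial_Lop_killed iso_trivial (f' x); exists d.
apply: eq_killed (linear_killed lf hd) => m.
by rewrite -{2}(fK' x); exact: (fL (VirL m)).
Qed.

Lemma iso_not_pair_killed : (R <= 3)%N -> False.
Proof.
move=> R3; have [g0 [h0 [g00 hE gE]]] := phi_coefs_linear alpha size_h.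
have [f [lf bf _]] := WX; have [w w0] := isomorphic_neq0 lf bf X_neq0.
apply: (trivial_not_pair_killed hE gE iso_trivial g00 w0) => x.
apply: killed_leq R3 _; have := iso_pair_killed 0 x.
by apply: eq_killed => m; rewrite sub0r.
Qed.

End PairKilled.

Lemma iso_not_almost_killed (x : X) : x != 0 ->
  (forall u : U, almost_killed (val lambda) 0 (fun k => Lop k u)) ->
  ~ almost_killed (val lambda) 2 (fun k => Lop k x).
Proof.
move=> x0 hU hx; have [g0 [h0 [g00 hE gE]]] := phi_coefs_linear alpha size_h.
have [f [lf bf fL]] := WX; have [f' f'K fK'] := bf.
have w0 : f' x != 0.
  by apply: contraNneq x0 => e; rewrite -(fK' x) e (linf0 lf).
apply: (not_almost_killed_Lop hE gE g00 w0 hU).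
apply: (almost_killed_inj lf (bij_inj bf)).
apply: eq_almost_killed hx => k; rewrite -{1}(fK' x); exact/esym/(fL (VirL k)).
Qed.

End PhiTensorNotIsomorphic.

Theorem theorem4p6 (R : realType) (n : nat)
    (lambda alpha : 'I_n -> nonzero R[i]) (h : 'I_n -> {poly R[i]})
    (V : lieModule (virasoro R[i])) :
  (1 <= n)%N ->
  injective lambda ->
  (forall i, size (h i) = 2%N) ->
  irreducible V -> eventually_locally_finite V ->
  let W := tensor_list [seq Phi (lambda i) (alpha i) (h i) | i <- enum 'I_n] V in
  (forall V' : lieModule (virasoro R[i]),
     irreducible V' -> eventually_locally_finite V' ->
     ~ isomorphic W V')
  /\ (forall (r : nat) (M : lieModule (trunc_virasoro R[i] r)) (gamma : {poly R[i]}),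
        irreducible M -> injective (Lbar (M := M) ord_max) ->
        (1 < size gamma)%N ->
        irreducible (LoopModule M gamma) ->
        ~ isomorphic W (LoopModule M gamma))
  /\ (forall (A : laurentDModule R[i]) (b' : R[i]),
        ld_irreducible A ->
        irreducible (Intermediate A b') ->
        ~ isomorphic W (Intermediate A b'))
  /\ (forall (m : nat) (mu : 'I_m -> nonzero R[i]) (b : 'I_m -> R[i])
         (V' : lieModule (virasoro R[i])),
        (1 <= m)%N ->
        (forall i, b i != 1) ->
        irreducible V' -> eventually_locally_finite V' ->
        let W' := tensor_list [seq Omega (mu i) (b i) | i <- enum 'I_m] V' in
        irreducible W' ->
        ~ isomorphic W W').
Proof.
move=> n_gt0 lambda_inj sh irrV lfV W.
(* One factor is split off; U collects the others together with V. *)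
have [i0 [s [es i0s]]] : exists i0 s, enum 'I_n = i0 :: s /\ i0 \notin s.
  have := enum_uniq 'I_n; have := size_enum_ord n; case: (enum 'I_n) => [|i s].
    by move=> n0; move: n_gt0; rewrite -n0.
  by move=> _ /andP[is_ _]; exists i, s.
pose U := tensor_list [seq Phi (lambda i) (alpha i) (h i) | i <- s] V.
have -> : W = tensor_module (Phi (lambda i0) (alpha i0) (h i0)) U.
  by rewrite /W es.
split=> [V' irrV' lfV' iso|].
  exact: (iso_not_eventually_locally_finite (sh i0) iso (proj1 irrV') lfV').
split=> [r M gamma irrM _ sg irrN iso|].
  (* An isomorphism would make n |-> L_n (v (x) 1) a polynomial times a geometric sequence. *)
  have [[v v0] _] := irrM.
  have [d] := iso_pair_killed_Lop_killed (sh i0) iso (@loop_pair_killed _ r M gamma)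
    (tens v << 0 >>).
  exact: (loop_not_killed v0 sg).
split=> [A b' _ irrA iso|m mu b V' _ _ irrV' lfV' W' _ iso].
  exact: (iso_not_pair_killed (sh i0) iso (proj1 irrA)
    (@intermediate_pair_killed _ A b')).
have [w w0 hw] := omega_list_almost_killed (enum 'I_m) mu b (val (lambda i0))
  (proj1 irrV') (irreducible_eventually0 irrV' lfV').
apply: (iso_not_almost_killed (sh i0) iso w0 _ hw).
apply: phi_list_almost_killed; last exact: irreducible_eventually0 irrV lfV.
(* The lambda_i are distinct, so no factor of U has the ratio of the factor split off. *)
move=> i si; apply: contraNneq i0s => /val_inj/lambda_inj <-; exact: si.
Qed.
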